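(* Every sequence $\{G_i\}_{i=1}^\infty$ of finite graphs, each having at least one edge, has a random walk convergent subsequence. If $\{G_i\}$ is random walk convergent, then there is a Markov graphop $A$ such that $\lim_{i\to\infty}d_M(M(G_i),A)=0$.
   Context: For a finite graph $G$ on $[n]$ with at least one edge, let $\nu_G$ be the probability measure on $[n]$ with $\nu_G(i)=d(i)/(2|E(G)|)$, $d(i)$ the degree, and $M(G)$ the operator on functions on $([n],\nu_G)$ given by $(vM(G))(i)=d(i)^{-1}\sum_{(i,j)\in E(G)}v(j)$ for $i$ in the support of $\nu_G$. A $P$-operator on a probability space $\Omega$ is a linear $A:L^\infty(\Omega)\to L^1(\Omega)$, $v\mapsto vA$, with $\sup_v\|vA\|_1/\|v\|_\infty<\infty$. With $(f,g)_A=\int(fA)g$, a Markov graphop is a $P$-operator that is self-adjoint ($(v,w)_A=(w,v)_A$), positivity-preserving ($v\ge0$ a.e. $\Rightarrow vA\ge0$ a.e.) and satisfies $1_\Omega A=1_\Omega$. $\mathcal{S}_k(A)$ is the set of joint distributions of $(v_1,\dots,v_k,v_1A,\dots,v_kA)$ over measurable $v_i:\Omega\to[-1,1]$; $d_M(A,B)=\sum_k2^{-k}d_H(\mathcal{S}_k(A),\mathcal{S}_k(B))$, $d_H$ the Hausdorff distance induced by the Lévy–Prokhorov metric. $\{G_i\}$ is random walk convergent if $\{M(G_i)\}$ is action convergent, i.e. each $\{\mathcal{S}_k(M(G_i))\}_i$ is $d_H$-Cauchy. *)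

(* Defs.v *)
From HB Require Import structures.
From mathcomp Require Import all_boot all_order all_algebra.
From mathcomp Require Import all_classical all_reals all_analysis.
Set Implicit Arguments. Unset Strict Implicit. Unset Printing Implicit Defensive.
Import Order.TTheory GRing.Theory Num.Theory.
Local Open Scope classical_set_scope.
Local Open Scope ring_scope.

Definition euclid_dist (R : realType) (m : nat) (x y : 'I_m -> R) : R :=
  Num.sqrt (\sum_(i < m) (x i - y i) ^+ 2).

Definition euclid_open (R : realType) (m : nat) (U : set ('I_m -> R)) : Prop :=
  forall x, U x -> exists2 r : R, 0 < r & forall y, euclid_dist x y < r -> U y.

Definition borel_Rm (R : realType) (m : nat) : set (set ('I_m -> R)) :=
  <<s [set U | @euclid_open R m U] >>.

(* a (probability) distribution on R^m, given by its values on Borel sets *)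
Definition law (R : realType) (m : nat) := set ('I_m -> R) -> R.

Definition eps_nbhd (R : realType) (m : nat) (B : set ('I_m -> R)) (e : R) :=
  [set x | exists2 y, B y & euclid_dist x y < e].

Definition LP_dist (R : realType) (m : nat) (mu nu : law R m) : R :=
  inf [set e : R | 0 < e /\ forall B, borel_Rm B ->
        mu B <= nu (eps_nbhd B e) + e /\ nu B <= mu (eps_nbhd B e) + e].

Definition hausdorff (R : realType) (m : nat) (X Y : set (law R m)) : R :=
  Num.max (sup [set r | exists2 x, X x & r = inf [set LP_dist x y | y in Y]])
          (sup [set r | exists2 y, Y y & r = inf [set LP_dist x y | x in X]]).

Definition stack (R : realType) (T : Type) (k : nat) (v w : 'I_k -> T -> R) (x : T)
  : 'I_(k + k) -> R :=
  fun j => match fintype.split j with inl a => v a x | inr b => w b x end.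

Definition profiles (R : realType) := forall k : nat, set (law R (k + k)).

Definition d_M (R : realType) (S1 S2 : profiles R) : R :=
  limn (fun N => \sum_(1 <= k < N) ((2 : R) ^- k) * hausdorff (S1 k) (S2 k)).

Section Ops.
Context (d : measure_display) (T : measurableType d) (R : realType).

Definition Linf (P : probability T R) (v : T -> R) : Prop :=
  measurable_fun setT v /\ exists c : R, {ae P, forall x, `|v x| <= c}.

Definition P_operator (P : probability T R) (A : (T -> R) -> (T -> R)) : Prop :=
  (forall v, Linf P v -> P.-integrable setT (EFin \o A v)) /\
  (forall v w, Linf P v -> Linf P w -> {ae P, forall x, v x = w x} ->
     {ae P, forall x, A v x = A w x}) /\
  (forall (a b : R) v w, Linf P v -> Linf P w ->
     {ae P, forall x, A (fun y => a * v y + b * w y) x = a * A v x + b * A w x}) /\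
  (exists C : R, forall v (c : R), Linf P v -> {ae P, forall x, `|v x| <= c} ->
     (\int[P]_x (`|A v x|)%:E <= (C * c)%:E)%E).

Definition markov_graphop (P : probability T R) (A : (T -> R) -> (T -> R)) : Prop :=
  P_operator P A /\
  (forall v w, Linf P v -> Linf P w ->
     (\int[P]_x (A v x * w x)%:E = \int[P]_x (A w x * v x)%:E)%E) /\
  (forall v, Linf P v -> {ae P, forall x, 0 <= v x} -> {ae P, forall x, 0 <= A v x}) /\
  {ae P, forall x, A (fun _ => 1) x = 1}.

Definition op_law (P : probability T R) (m : nat) (X : T -> 'I_m -> R) : law R m :=
  fun B => fine (P (X @^-1` B)).

Definition op_profile (P : probability T R) (A : (T -> R) -> (T -> R)) : profiles R :=
  fun k => [set op_law P (stack v (fun a => A (v a))) | v in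
            [set v : 'I_k -> T -> R | forall a, measurable_fun setT (v a) /\
                                       forall x, -1 <= v a x <= 1]].
End Ops.
Arguments op_profile {d T R} P A k.

Record simple_graph := FGraph {
  gn : nat;
  gadj : rel 'I_gn;
  gadj_sym : symmetric gadj;
  gadj_irr : irreflexive gadj }.
Arguments gadj : clear implicits.

Definition deg (G : simple_graph) (i : 'I_(gn G)) : nat := #|[set j | gadj G i j]|.

Definition nedges (G : simple_graph) : nat :=
  #|[set p : 'I_(gn G) * 'I_(gn G) | gadj G p.1 p.2 && (p.1 < p.2)%N]|.

Definition has_edge (G : simple_graph) : Prop := (0 < nedges G)%N.

Definition nu (R : realType) (G : simple_graph) (i : 'I_(gn G)) : R :=
  (deg i)%:R / (2 * nedges G)%:R.

Definition MG (R : realType) (G : simple_graph) (v : 'I_(gn G) -> R) (i : 'I_(gn G)) : R :=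
  ((deg i)%:R)^-1 * \sum_(j | gadj G i j) v j.

Definition graph_law (R : realType) (G : simple_graph) (m : nat) (X : 'I_(gn G) -> 'I_m -> R)
  : law R m :=
  fun B => \sum_(i : 'I_(gn G)) nu R i * \1_B (X i).

Definition graph_profile (R : realType) (G : simple_graph) : profiles R :=
  fun k => [set graph_law (stack v (fun a => MG (v a))) | v in
            [set v : 'I_k -> 'I_(gn G) -> R | forall a x, -1 <= v a x <= 1]].
Arguments graph_profile R G k : clear implicits.

Definition rw_convergent (R : realType) (G : nat -> simple_graph) : Prop :=
  forall k : nat, (0 < k)%N -> forall e : R, 0 < e ->
    exists N : nat, forall i j : nat, (N <= i)%N -> (N <= j)%N ->
      hausdorff (graph_profile R (G i) k) (graph_profile R (G j) k) < e.

(* Main.v *)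
(* The limit operator lives on an ultraproduct.  Fix a free ultrafilter on the
   naturals and let Omega be the product of the vertex sets.  Sets of the form
   "x_i is in S_i for almost all i" carry the mass lim nu_i(S_i); by a diagonal
   argument (countable saturation) the sets that agree with such an internal set
   up to outer-null sets form a sigma-algebra on which the mass is a probability
   (the Loeb measure).  Binary expansions show that every bounded measurable
   function is almost everywhere the standard part x |-> lim F_i(x_i) of a
   bounded sequence of functions F_i on the vertices, and A sends it to the
   standard part of M(G_i) F_i; this is well defined because M(G_i) contracts the
   L^1 norm.  Partitioning the cube into finitely many dyadic cells shows that
   the law of (F_i, M(G_i) F_i) tends to that of the standard parts, whence
   S_k(M(G_i)) tends to S_k(A) along the ultrafilter for every sequence of
   graphs.  This gives the convergent subsequence; and if the profiles are
   already Cauchy, they converge to S_k(A) along the whole sequence. *)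
Require Import Defs.
From HB Require Import structures.
From mathcomp Require Import all_boot all_order all_algebra.
From mathcomp Require Import all_classical all_reals all_analysis.
From mathcomp Require Import measurable_realfun ring lra.
Set Implicit Arguments. Unset Strict Implicit. Unset Printing Implicit Defensive.
Import Order.TTheory GRing.Theory Num.Theory.
Import numFieldNormedType.Exports.
Local Open Scope classical_set_scope.
Local Open Scope ring_scope.


(** * The ultrafilter and the Loeb space *)

(** The obstacle is that one space must carry the limits of all test functions at once. A weak limit
    of joint laws serves countably many functions, whereas a profile ranges over all measurable
    ones, including functions that exist only on the limit space and have to be pulled back to the
    vertices. On the ultraproduct both passages exist: bounded sequences have standard parts,
    bounded measurable functions have lifts, and the walk operators act factorwise in between. Lifts
    are determined only up to errors that are small in mean, not in sup norm, so boundedness on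
    L^infinity alone would not make the operator well defined. Hausdorff convergence also asks for
    uniformity over each profile. From the graphs to the limit it is automatic, since a sequence of
    worst cases is itself a single internal function. In the other direction the worst cases all
    live on the limit space, and total boundedness takes over: finitely many cell masses determine a
    law up to a small error. *)

Definition fultra : set_system nat :=
  sval (cid (ultraFilterLemma eventually_filter)).

#[global] Instance fultra_ultra : UltraFilter fultra.
Proof. by rewrite /fultra; case: cid => ? []. Qed.

Lemma fultra_oo (P : set nat) : (\forall i \near \oo, P i) -> \forall i \near fultra, P i.
Proof. by rewrite /fultra; case: cid => F /= [_ h] /h. Qed.

Lemma fultra_dec (P : nat -> Prop) :
  (\forall i \near fultra, P i) \/ (\forall i \near fultra, ~ P i).
Proof. exact: in_ultra_setVsetC. Qed.

Lemma fultra_not (P : nat -> Prop) :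
  ~ (\forall i \near fultra, P i) -> \forall i \near fultra, ~ P i.
Proof. by case: (fultra_dec P). Qed.

(** If every colour were avoided almost always, a finite intersection would avoid all of them at
    once. This is the compactness used below: it fixes the cell of a point and the digit code of a
    law. *)
Lemma fultra_pigeonhole (K : finType) (c : nat -> K) :
  exists k, \forall i \near fultra, c i = k.
Proof.
apply: contrapT => /forallNP h.
have {}h k : \forall i \near fultra, c i != k.
  by apply: filterS (fultra_not (h k)) => i /eqP.
have : \forall i \near fultra, forall k, c i != k by exact: filter_forall.
by move=> /filter_ex[i /(_ (c i))]; rewrite eqxx.
Qed.

(* Countable saturation: [s i] is the last [n <= i] such that [E n i]. *)
Lemma fultra_diag (E : nat -> nat -> Prop) :
  (forall n, \forall i \near fultra, E n i) ->
  exists s : nat -> nat, (\forall i \near fultra, E (s i) i) /\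
    forall n, \forall i \near fultra, (n <= s i)%N.
Proof.
move=> EU; exists (fun i => \max_(n < i.+1 | `[< E n i >]) n)%N; split.
  (* With no valid [n] the maximum would be the default 0; [E 0] excludes this almost always. *)
  apply: filterS (EU 0%N) => i E0.
  have : (0 < #|[pred n : 'I_i.+1 | `[< E n i >]]|)%N.
    by apply/card_gt0P; exists ord0; rewrite unfold_in; apply/asboolP.
  by move=> /(eq_bigmax_cond (fun n : 'I_i.+1 => n : nat))[n /asboolP En ->].
move=> n; have : \forall i \near fultra, (n <= i)%N by apply: fultra_oo; exact: nbhs_infty_ge.
apply: filterS2 (EU n) => i En ni.
rewrite -ltnS in ni.
by apply: (@leq_bigmax_cond _ _ _ (Ordinal ni)); exact/asboolP.
Qed.

Lemma fultra_ex2 (P Q : nat -> Prop) : (\forall i \near fultra, P i) ->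
  (\forall i \near fultra, Q i) -> exists i, P i /\ Q i.
Proof. by move=> hP hQ; apply: (@filter_ex _ fultra); exact: filterI. Qed.

Section Ulim.
Variable R : realType.
Implicit Types u v : nat -> R.

(** The image of an ultrafilter is an ultrafilter, and this one lives on the compact segment from
    [- C] to [C]. *)
Lemma bounded_cvg_ultra u (C : R) : (forall i, `|u i| <= C) ->
  cvg (u @ fultra).
Proof.
move=> uC.
have := @segment_compact R (- C) C; rewrite compact_ultra => /(_ (u @ fultra)).
case.
- split=> [|G GP sG]; first exact: fmap_proper_filter.
  apply/seteqP; split=> [A GA|]; last exact: sG.
  have [//|hA] := fultra_dec (fun i => A (u i)).
  have : G (A `&` ~` A) by apply: filterI => //; exact: sG.
  by rewrite setICr => /filter_not_empty.
- by apply: (@filterE _ fultra) => i /=; rewrite in_itv/= -ler_norml.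
by move=> p [_ up]; apply/cvg_ex; exists p.
Qed.

Lemma ultra_cvg_sum n (u : 'I_n -> nat -> R) (l : 'I_n -> R) :
  (forall k, u k @ fultra --> l k) ->
  (fun i => \sum_(k < n) u k i) @ fultra --> \sum_(k < n) l k.
Proof. by move=> ul; apply: cvg_big => //; exact: add_continuous. Qed.

Definition ulim u : R := lim (u @ fultra).

Lemma ulimP u (C : R) : (forall i, `|u i| <= C) -> u @ fultra --> ulim u.
Proof. by move=> /bounded_cvg_ultra. Qed.

Lemma ulim_eq u (l : R) : u @ fultra --> l -> ulim u = l.
Proof. by move=> /cvg_lim; apply. Qed.

Lemma ultra_le u v (a b : R) : u @ fultra --> a -> v @ fultra --> b ->
  (\forall i \near fultra, u i <= v i) -> a <= b.
Proof. by move=> ua vb uv; apply: ler_cvg_to ua vb uv. Qed.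

Lemma ultra_near_dist u (a e : R) : u @ fultra --> a -> 0 < e ->
  \forall i \near fultra, `|u i - a| < e.
Proof.
by move=> /cvgrPdist_lt ua e0; apply: filterS (ua _ e0) => i; rewrite distrC.
Qed.

Lemma ultra_cvgP u (a : R) : (forall e : R, 0 < e -> \forall i \near fultra, `|u i - a| <= e) ->
  u @ fultra --> a.
Proof.
by move=> h; apply/cvgrPdist_le => e e0; apply: filterS (h _ e0) => i; rewrite distrC.
Qed.

End Ulim.

(** * Finite probability spaces, the factors of the ultraproduct *)

Record fprob (R : realType) := FProb {
  fcar :> finType;
  fmass : fcar -> R;
  fmass_ge0 : forall x, 0 <= fmass x;
  fmass_sum1 : \sum_x fmass x = 1 }.

Section FiniteExpectation.
Variables (R : realType) (W : fprob R).
Implicit Types (F H : W -> R) (S T : pred W).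

Definition fexp F : R := \sum_x fmass x * F x.

Definition fpr S : R := fexp (fun x => (S x)%:R).

Lemma fexpD F H : fexp (fun x => F x + H x) = fexp F + fexp H.
Proof. by rewrite /fexp -big_split/=; apply: eq_bigr => x _; rewrite mulrDr. Qed.

Lemma fexpZ a F : fexp (fun x => a * F x) = a * fexp F.
Proof. by rewrite /fexp mulr_sumr; apply: eq_bigr => x _; rewrite mulrCA. Qed.

Lemma fexp_cst a : fexp (fun=> a) = a.
Proof. by rewrite /fexp -mulr_suml fmass_sum1 mul1r. Qed.

Lemma fexp_sum n (F : 'I_n -> W -> R) :
  fexp (fun x => \sum_(k < n) F k x) = \sum_(k < n) fexp (F k).
Proof.
by rewrite /fexp exchange_big/=; apply: eq_bigr => x _; rewrite mulr_sumr.
Qed.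

Lemma le_fexp F H : (forall x, F x <= H x) -> fexp F <= fexp H.
Proof. by move=> FH; apply: ler_sum => x _; rewrite ler_wpM2l// fmass_ge0. Qed.

Lemma fexp_norm F : `|fexp F| <= fexp (fun x => `|F x|).
Proof.
apply: le_trans (ler_norm_sum _ _ _) _; apply: ler_sum => x _.
by rewrite normrM ger0_norm// fmass_ge0.
Qed.

Lemma fexp_bound F C : (forall x, `|F x| <= C) -> `|fexp F| <= C.
Proof.
move=> FC; apply: le_trans (fexp_norm F) _.
by rewrite -[leRHS]fexp_cst; apply: le_fexp.
Qed.

Lemma fpr_ge0 S : 0 <= fpr S.
Proof. by apply: sumr_ge0 => x _; rewrite mulr_ge0// fmass_ge0. Qed.

Lemma le_fpr S T : (forall x, S x -> T x) -> fpr S <= fpr T.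
Proof.
by move=> ST; apply: le_fexp => x; rewrite ler_nat; case: (S x) (ST x) => // ->.
Qed.

Lemma fprT : fpr xpredT = 1. Proof. exact: fexp_cst. Qed.

Lemma fpr0 : fpr xpred0 = 0. Proof. exact: fexp_cst. Qed.

Lemma fpr_le1 S : fpr S <= 1.
Proof. by rewrite -fprT; apply: le_fpr. Qed.

Lemma fpr_norm S : `|fpr S| <= 1.
Proof. by rewrite ger0_norm ?fpr_ge0 ?fpr_le1. Qed.

Lemma fprUI S T : fpr (fun x => S x || T x) + fpr (fun x => S x && T x) = fpr S + fpr T.
Proof.
rewrite /fpr -!fexpD; apply: eq_bigr => x _ /=; congr (_ * _).
by case: (S x); case: (T x) => /=; rewrite ?addr0 ?add0r.
Qed.

Lemma fpr_exists S : 0 < fpr S -> exists x, S x.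
Proof.
move=> S0; apply: contrapT => /forallNP nS.
suff S00 : fpr S = 0 by rewrite S00 ltxx in S0.
rewrite -fpr0; apply: eq_bigr => x _; by move: (nS x) => /negP/negbTE ->.
Qed.

End FiniteExpectation.

(** * The Loeb measure *)

Section Loeb.
Variables (R : realType) (W : nat -> fprob R).

(** Points are sequences rather than classes modulo the ultrafilter: internal sets do not separate
    sequences that agree almost always, so the quotient can be avoided. *)
Definition loeb := forall i, W i.
Definition isets := forall i, pred (W i).
Implicit Types S T : isets.

Lemma fprob_inhabited i : exists x : W i, true.
Proof. by apply: fpr_exists; rewrite fprT. Qed.

Definition loeb_point : loeb := fun i => sval (cid (fprob_inhabited i)).

Definition iset (S : isets) : set loeb :=
  [set x | \forall i \near fultra, S i (x i)].

Definition imass (S : isets) : R := ulim (fun i => fpr (S i)).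

Lemma imass_cvg S : (fun i => fpr (S i)) @ fultra --> imass S.
Proof. by apply: (@ulimP _ _ 1) => i; exact: fpr_norm. Qed.

Arguments imass_cvg : clear implicits.

Lemma isetC S : iset (fun i x => ~~ S i x) = ~` iset S.
Proof.
apply/seteqP; split=> x /=; rewrite /iset/=.
  by move=> nS yS; have [i [/negP]] := fultra_ex2 nS yS.
by move=> /fultra_not; apply: filterS => i /negP.
Qed.

Lemma isetI S T : iset (fun i x => S i x && T i x) = iset S `&` iset T.
Proof.
apply/seteqP; split=> x /=; rewrite /iset/=.
  by move=> h; split; apply: filterS h => i /andP[].
by move=> [hS hT]; apply: filterS2 hS hT => i /= -> ->.
Qed.

Lemma isetU S T : iset (fun i x => S i x || T i x) = iset S `|` iset T.
Proof.
rewrite -[RHS]setCK setCU -!isetC -isetI -isetC; congr iset.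
by apply: functional_extensionality_dep => i; apply/funext => x /=; rewrite negb_and !negbK.
Qed.

Lemma sub_iset S T : (\forall i \near fultra, forall x, S i x -> T i x) ->
  iset S `<=` iset T.
Proof. by move=> h x; apply: filterS2 h => i; apply. Qed.

(** Counterexamples chosen in the separate factors assemble into one point of the product. Inclusion
    of internal sets is thus decided factorwise, which makes [imass] depend on the set [iset S]
    only. *)
Lemma iset_sub S T : iset S `<=` iset T ->
  \forall i \near fultra, forall x, S i x -> T i x.
Proof.
move=> ST; apply: contrapT => /fultra_not h.
pose y i := if pselect (exists x, S i x && ~~ T i x) is left e then sval (cid e)
            else loeb_point i.
have yh : \forall i \near fultra, S i (y i) && ~~ T i (y i).
  apply: filterS h => i /existsNP[x /not_implyP[Sx /negP Tx]]; rewrite /y.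
  by case: pselect => [e|[]]; [case: (cid e)|exists x; rewrite Sx].
have /ST : iset S y by apply: filterS yh => i /andP[].
by move=> Ty; have [i [/andP[_ /negP]]] := fultra_ex2 yh Ty.
Qed.

Lemma le_imass S T : iset S `<=` iset T -> imass S <= imass T.
Proof.
move=> /iset_sub ST; apply: (ultra_le (imass_cvg S) (imass_cvg T)).
by apply: filterS ST => i; exact: le_fpr.
Qed.

Lemma imass_ge0 S : 0 <= imass S.
Proof.
apply: (ultra_le (cvg_cst 0) (imass_cvg S)); apply: filterE => i; exact: fpr_ge0.
Qed.

Lemma imassUI S T : imass (fun i x => S i x || T i x) +
  imass (fun i x => S i x && T i x) = imass S + imass T.
Proof.
apply: (@cvg_unique R (@Rhausdorff R) ((fun i => fpr (S i) + fpr (T i)) @ fultra)).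
  rewrite (_ : (fun i => _) = fun i => fpr (fun x => S i x || T i x) +
    fpr (fun x => S i x && T i x)); last by apply/funext => i; rewrite fprUI.
  by apply: cvgD; exact: imass_cvg.
by apply: cvgD; exact: imass_cvg.
Qed.

Lemma imassT : imass (fun=> xpredT) = 1.
Proof. by apply: ulim_eq; under eq_cvg do rewrite fprT; exact: cvg_cst. Qed.

Lemma imass0 : imass (fun=> xpred0) = 0.
Proof. by apply: ulim_eq; under eq_cvg do rewrite fpr0; exact: cvg_cst. Qed.

Lemma imassU_le S T : imass (fun i x => S i x || T i x) <= imass S + imass T.
Proof. by rewrite -imassUI lerDl imass_ge0. Qed.

Definition lnull (N : set loeb) : Prop :=
  forall e : R, 0 < e -> exists2 S, N `<=` iset S & imass S < e.

Lemma sub_lnull N N' : N `<=` N' -> lnull N' -> lnull N.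
Proof. by move=> NN' h e /h[S NS Se]; exists S => //; exact: subset_trans NS. Qed.

Lemma lnull_iset S : lnull (iset S) <-> imass S = 0.
Proof.
split=> [h|S0 e e0]; last by exists S; rewrite ?S0.
apply/eqP; rewrite eq_le imass_ge0 andbT; apply/ler_addgt0Pr => e /h[T ST Te].
by rewrite add0r; apply: le_trans (le_imass ST) (ltW Te).
Qed.

Definition isetsU S T : isets := fun i x => S i x || T i x.

Fixpoint iunion (S : nat -> isets) (n : nat) : isets :=
  if n is m.+1 then isetsU (iunion S m) (S m) else fun=> xpred0.
Arguments iunion : clear implicits.

Lemma iunionP (S : nat -> isets) n x : iset (iunion S n) x <-> exists2 m, (m < n)%N & iset (S m) x.
Proof.
elim: n => [|n IH].
  split=> [|[]//]; rewrite /iset/= => /filter_ex[i].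
  by [].
rewrite /= isetU; split=> [[/IH[m mn Sm]|Sn]|[m]].
- by exists m => //; exact: ltnW.
- by exists n.
- by rewrite ltnS leq_eqVlt => /predU1P[->|mn] Sm; [right|left; apply/IH; exists m].
Qed.

Lemma iunion_mem (S : nat -> isets) n i (x : W i) : iunion S n i x <-> exists2 m, (m < n)%N & S m i x.
Proof.
elim: n => [|n IH] /=; first by split=> // -[].
split=> [/orP[/IH[m mn Sm]|Sn]|[m]].
- by exists m => //; exact: ltnW.
- by exists n.
- by rewrite ltnS leq_eqVlt => /predU1P[->|mn] Sm; apply/orP; [right|left; apply/IH; exists m].
Qed.

(* [T] takes [s i] of the sets in the [i]-th factor, where [s] comes from
   saturation and grows slowly enough to respect the bound on the mass. *)
Lemma iunion_sup (S : nat -> isets) (c : R) : (forall n, imass (iunion S n) <= c) ->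
  exists T, (forall n, iset (S n) `<=` iset T) /\ imass T <= c.
Proof.
move=> Sc.
have /fultra_diag[s [sE s_oo]] n : \forall i \near fultra,
    fpr (iunion S n i) <= c + n.+1%:R^-1.
  have n0 : 0 < n.+1%:R^-1 :> R by rewrite invr_gt0.
  apply: filterS (ultra_near_dist (imass_cvg (iunion S n)) n0) => i /ltr_distlDr.
  by move=> /ltW/le_trans; apply; rewrite lerD2r.
exists (fun i => iunion S (s i) i); split.
  move=> n; apply: sub_iset; apply: filterS (s_oo n.+1) => i ni x Sx.
  by apply/iunion_mem; exists n.
apply/ler_addgt0Pr => e e0.
pose n := Num.truncn e^-1.
have ne : n.+1%:R^-1 <= e.
  by rewrite invf_ple ?posrE// ltW// Num.Theory.truncnS_gt.
apply: (ultra_le (imass_cvg _) (cvg_cst (c + e))).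
apply: filterS2 sE (s_oo n) => i si ni; apply: le_trans si _.
rewrite lerD2l; apply: le_trans ne; rewrite lef_pV2 ?posrE// ler_nat ltnS //.
Qed.

(** A countable union of internal covers need not be internal; [iunion_sup] encloses it in an
    internal set under the same bound on the mass. *)
Lemma lnull_bigcup (N : nat -> set loeb) : (forall n, lnull (N n)) ->
  lnull (\bigcup_n N n).
Proof.
move=> hN e e0.
(* These masses add up to at most [e / 2]; the spare factor 2 restores the strict inequality, since
   [iunion_sup] yields a weak one. *)
have /choice[S SP] n : exists S, N n `<=` iset S /\ imass S < e / 2 / (2 ^ n.+1)%:R.
  have e'0 : 0 < e / 2 / (2 ^ n.+1)%:R by rewrite !divr_gt0 // ltr0n expn_gt0.
  by have [S] := hN n _ e'0; exists S.
have bnd n : imass (iunion S n) <= e / 2.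
  apply: (@le_trans _ _ (e / 2 * (1 - (2 ^ n)%:R^-1))); last first.
    by rewrite ler_piMr ?divr_ge0 ?(ltW e0)// gerBl invr_ge0.
  elim: n => [|n IH] /=; first by rewrite imass0 expn0 invr1 subrr mulr0.
  apply: le_trans (imassU_le _ _) _.
  apply: le_trans (lerD IH (ltW (SP n).2)) _.
  rewrite expnS natrM -mulrDr ler_pM2l ?divr_gt0//.
  have : (2 ^ n)%:R != 0 :> R by rewrite pnatr_eq0 expn_eq0.
  by move=> h; rewrite le_eqVlt; apply/orP; left; apply/eqP; field.
have [T [ST Te]] := iunion_sup bnd.
exists T; first by move=> x [n _ /(SP n).1 /ST].
by apply: le_lt_trans Te _; rewrite gtr_pMr// invf_lt1 // ltr1n.
Qed.

Lemma lnull0 : lnull set0.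
Proof. by move=> e e0; exists (fun=> xpred0) => //; rewrite imass0. Qed.

Lemma lnullU N N' : lnull N -> lnull N' -> lnull (N `|` N').
Proof.
move=> h h'; rewrite -bigcup2E; apply: lnull_bigcup => -[|[|n]] //=; exact: lnull0.
Qed.

Definition lrep (B : set loeb) S : Prop := lnull [set x | ~ (B x <-> iset S x)].

Lemma lrep_iset S : lrep (iset S) S.
Proof. by apply: sub_lnull lnull0 => x; apply. Qed.

Lemma lrepC B S : lrep B S -> lrep (~` B) (fun i x => ~~ S i x).
Proof.
apply: sub_lnull => x /=; apply: contra_not; rewrite isetC /=.
by move=> ->.
Qed.

(** An internal set [T] of mass below [e] covers both error sets, so [iset S] lies in the union of
    [iset S'] and [iset T]. For [B = B'] this makes the mass independent of the representative. *)
Lemma lrep_imass_le B B' S S' : lrep B S -> lrep B' S' -> B `<=` B' ->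
  imass S <= imass S'.
Proof.
move=> BS BS' BB'; apply/ler_addgt0Pr => e e0.
have [T hT Te] := lnullU BS BS' e0.
apply: (@le_trans _ _ (imass (fun i x => S' i x || T i x))).
  apply: le_imass; rewrite isetU => x Sx.
  have [TT|nT] := pselect (iset T x); [by right|left].
  have /not_orP[/= /contrapT h /contrapT h'] := (fun h => nT (hT x h)).
  by apply/h'/BB'/h.
by apply: le_trans (imassU_le _ _) _; rewrite lerD2l ltW.
Qed.

(** The set [T] from [iunion_sup] exceeds the union of the [iset (S n)] by less than its excess over
    each finite union, and the mass of that excess tends to 0. The limit in the conclusion is what
    sigma-additivity rests on. *)
Lemma lrep_bigcup (B : nat -> set loeb) (S : nat -> isets) : (forall n, lrep (B n) (S n)) ->
  exists T, lrep (\bigcup_n B n) T /\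
    (fun n => imass (iunion S n)) @ \oo --> imass T.
Proof.
move=> BS; pose u n := imass (iunion S n).
have u_nd : nondecreasing_seq u.
  apply/nondecreasing_seqP => n; apply: le_imass => x /iunionP[m mn Sm].
  by apply/iunionP; exists m => //; exact: ltnW.
have u_cvg : cvgn u.
  apply: nondecreasing_is_cvgn => //; exists 1 => _ [n _ <-].
  by rewrite -imassT; apply: le_imass => x _; exact: filterE.
have [T [ST Tc]] := iunion_sup (fun n => nondecreasing_cvgn_le u_nd u_cvg n).
have uT n : u n <= imass T.
  by apply: le_imass => x /iunionP[m _ /ST].
exists T; split; last first.
  suff -> : imass T = limn u by [].
  by apply/eqP; rewrite eq_le Tc limr_le//; exact: nearW.
apply: (@sub_lnull _ ((\bigcup_n [set x | ~ (B n x <-> iset (S n) x)]) `|`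
    (iset T `\` \bigcup_n iset (S n)))); last first.
  apply: lnullU; first exact: lnull_bigcup.
  move=> e e0; have := (cvgrPdist_lt _ _).1 u_cvg _ e0 => -[n _ /(_ n (leqnn n)) un].
  exists (fun i x => T i x && ~~ iunion S n i x).
    rewrite isetI isetC => x [Tx nS]; split=> // /iunionP[m _ Sm].
    by apply: nS; exists m.
  have := imassUI (fun i x => T i x && ~~ iunion S n i x) (iunion S n).
  rewrite [X in _ + X]((lnull_iset _).1 _); last first.
    by rewrite !isetI isetC; apply: sub_lnull lnull0 => x [[_]]/=.
  rewrite addr0 => eq1.
  have : imass T >= imass (fun i x =>
      T i x && ~~ iunion S n i x || iunion S n i x).
    apply: le_imass; rewrite isetU isetI; move=> x [[]//|].
    by move=> /iunionP[m _ /ST].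
  move: un; rewrite ger0_norm ?subr_ge0 ?nondecreasing_cvgn_le// /u => un.
  rewrite eq1; lra.
move=> x /= nBT; apply: contrapT => /not_orP[hB hT]; apply: nBT; split.
  move=> [n _ Bn]; apply: (ST n).
  have /contrapT h : ~ ~ (B n x <-> iset (S n) x) by move=> h; apply: hB; exists n.
  exact/h.
move=> Tx; apply: contrapT => nB; apply: hT; split=> // -[n _ Sn].
have /contrapT h : ~ ~ (B n x <-> iset (S n) x) by move=> h; apply: hB; exists n.
by apply: nB; exists n => //; exact/h.
Qed.

Definition lmeas (B : set loeb) : Prop := exists S, lrep B S.

Definition lmass (B : set loeb) : R :=
  if pselect (lmeas B) is left h then imass (sval (cid h)) else 0.

Lemma lmassE B S : lrep B S -> lmass B = imass S.
Proof.
move=> BS; rewrite /lmass; case: pselect => [h|[]]; last by exists S.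
case: cid => S' BS' /=; apply/eqP; rewrite eq_le.
by apply/andP; split; [exact: lrep_imass_le BS' BS _|exact: lrep_imass_le BS BS' _].
Qed.

Lemma lmeas0 : lmeas set0.
Proof. by exists (fun=> xpred0); apply: sub_lnull lnull0 => x /=; apply; split => // /filter_ex[]. Qed.

Lemma lmeasC B : lmeas B -> lmeas (~` B).
Proof. by move=> [S /lrepC]; exists (fun i x => ~~ S i x). Qed.

Lemma lmeas_bigcup (B : (set loeb)^nat) : (forall i, lmeas (B i)) ->
  lmeas (\bigcup_i B i).
Proof. by move=> /choice[S /lrep_bigcup[T []]]; exists T. Qed.

HB.instance Definition _ := gen_eqMixin loeb.
HB.instance Definition _ := gen_choiceMixin loeb.
HB.instance Definition _ := isPointed.Build loeb loeb_point.
HB.instance Definition _ := @isMeasurable.Build default_measure_display loeb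
  lmeas lmeas0 lmeasC lmeas_bigcup.

Definition lprob (B : set loeb) : \bar R := (lmass B)%:E.

Lemma lprob0 : lprob set0 = 0%E.
Proof.
rewrite /lprob (@lmassE _ (fun=> xpred0)) ?imass0//.
by apply: sub_lnull lnull0 => x /=; apply; split => // /filter_ex[].
Qed.

Lemma lprob_ge0 B : (0 <= lprob B)%E.
Proof. by rewrite lee_fin /lmass; case: pselect => // h; exact: imass_ge0. Qed.

Lemma lprob_sigma_additive : semi_sigma_additive lprob.
Proof.
move=> B /choice[S BS] tB _; have [T [BT uT]] := lrep_bigcup BS.
rewrite /lprob (lmassE BT).
(* Representatives of disjoint sets may overlap, but only in a null set, so their masses still
   add. *)
have E n : imass (iunion S n) = \sum_(0 <= m < n) lmass (B m).
  elim: n => [|n IH]; first by rewrite big_geq//= imass0.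
  rewrite big_nat_recr//= -IH (lmassE (BS n)) -imassUI.
  rewrite [X in _ = _ + X]((lnull_iset _).1 _) ?addr0//.
  apply: sub_lnull (lnull_bigcup BS) => x; rewrite isetI => -[/iunionP[m mn Sm] Sn].
  have [h|h] := pselect (B n x <-> iset (S n) x); last by exists n.
  exists m => //= h'; have : (B m `&` B n) x by split; [apply/h'|apply/h].
  by move: tB => /trivIsetP/(_ m n Logic.I Logic.I)->//; rewrite neq_ltn mn.
rewrite (_ : (fun n => _) = fun n => (imass (iunion S n))%:E); last first.
  by apply/funext => n; rewrite E sumEFin.
by apply: cvg_EFin uT; exact: nearW.
Qed.

HB.instance Definition _ := isMeasure.Build _ loeb R lprob
  lprob0 lprob_ge0 lprob_sigma_additive.

Lemma lprobT : lprob setT = 1%E.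
Proof.
rewrite /lprob (@lmassE _ (fun=> xpredT)) ?imassT//.
by apply: sub_lnull lnull0 => x /=; apply; split=> // _; exact: filterE.
Qed.

HB.instance Definition _ := Measure_isProbability.Build _ _ _ lprob lprobT.

Lemma measurable_iset S : measurable (iset S).
Proof. by exists S; exact: lrep_iset. Qed.

Lemma lprob_iset S : lprob (iset S) = (imass S)%:E.
Proof. by rewrite /lprob (lmassE (lrep_iset S)). Qed.

Lemma lnull_measurable N : lnull N -> measurable N.
Proof.
move=> h; exists (fun=> xpred0); apply: sub_lnull h => x /=; apply: contra_notP => nN.
by split=> // /filter_ex[].
Qed.

Lemma lnullP N : lnull N <-> lprob.-negligible N.
Proof.
split=> [N0|[B [[S BS] B0 NB]]].
  exists N; split => //; first exact: lnull_measurable.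
  rewrite /lprob (@lmassE _ (fun=> xpred0)) ?imass0//.
  apply: sub_lnull N0 => x /=; apply: contra_notP => nN.
  by split=> // /filter_ex[].
apply: sub_lnull NB _; move: B0; rewrite /lprob /= (lmassE BS) => -[S0].
apply: sub_lnull (lnullU BS ((lnull_iset S).2 S0)) => x Bx.
have [Sx|nS] := pselect (iset S x); [by right|left => /= h].
exact/nS/h.
Qed.

Lemma lprob_aeP (Q : loeb -> Prop) :
  {ae lprob, forall x, Q x} <-> lnull [set x | ~ Q x].
Proof. by rewrite lnullP. Qed.

End Loeb.
Arguments imass_cvg {R W} S.

(** * Lévy–Prokhorov and Hausdorff distances *)

Section Euclid.
Variables (R : realType) (m : nat).
Implicit Types (x y z : 'I_m -> R) (B : set ('I_m -> R)).

Lemma sum_sqr_ge0 (u : 'I_m -> R) : 0 <= \sum_(i < m) u i ^+ 2.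
Proof. by apply: sumr_ge0 => i _; exact: sqr_ge0. Qed.

Lemma sum_sqr_eq0 (u : 'I_m -> R) : \sum_(i < m) u i ^+ 2 = 0 -> forall i, u i = 0.
Proof.
move/psumr_eq0P => h i; apply/eqP; rewrite -sqrf_eq0; apply/eqP.
by apply: h => // j _; exact: sqr_ge0.
Qed.

Lemma sum_cauchy_schwarz (u w : 'I_m -> R) : \sum_(i < m) u i * w i <=
  Num.sqrt (\sum_(i < m) u i ^+ 2) * Num.sqrt (\sum_(i < m) w i ^+ 2).
Proof.
set s := Num.sqrt _; set t := Num.sqrt _.
have s0 : 0 <= s by exact: sqrtr_ge0.
have t0 : 0 <= t by exact: sqrtr_ge0.
have Es : \sum_(i < m) u i ^+ 2 = s ^+ 2 by rewrite sqr_sqrtr ?sum_sqr_ge0.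
have Et : \sum_(i < m) w i ^+ 2 = t ^+ 2 by rewrite sqr_sqrtr ?sum_sqr_ge0.
have [s00|sn0] := eqVneq s 0.
  rewrite s00 mul0r big1// => i _.
  by rewrite (sum_sqr_eq0 (_ : \sum_(i < m) u i ^+ 2 = 0)) ?mul0r// Es s00 expr0n.
have [t00|tn0] := eqVneq t 0.
  rewrite t00 mulr0 big1// => i _.
  by rewrite (sum_sqr_eq0 (_ : \sum_(i < m) w i ^+ 2 = 0)) ?mulr0// Et t00 expr0n.
have st0 : 0 < s * t by rewrite mulr_gt0 ?lt0r ?sn0 ?tn0.
(* After multiplication by [2 * (s * t)] the claim is the sum over [i] of
   [0 <= (t * u i - s * w i) ^+ 2]. *)
rewrite -(ler_pM2l st0) -(ler_pM2l (ltr0Sn R 1)) !mulr_sumr.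
apply: (@le_trans _ _ (\sum_(i < m) (t ^+ 2 * u i ^+ 2 + s ^+ 2 * w i ^+ 2))).
  by apply: ler_sum => i _; have := sqr_ge0 (t * u i - s * w i); nra.
by rewrite big_split/= -!mulr_sumr Es Et; nra.
Qed.

Lemma euclid_dist_triangle x y z :
  euclid_dist x z <= euclid_dist x y + euclid_dist y z.
Proof.
rewrite /euclid_dist; set s := Num.sqrt (\sum_(i < m) (x i - y i) ^+ 2).
set t := Num.sqrt (\sum_(i < m) (y i - z i) ^+ 2).
have s0 : 0 <= s by exact: sqrtr_ge0.
have t0 : 0 <= t by exact: sqrtr_ge0.
rewrite -[leRHS]ger0_norm ?addr_ge0// -sqrtr_sqr ler_wsqrtr//.
have Es : \sum_(i < m) (x i - y i) ^+ 2 = s ^+ 2 by rewrite sqr_sqrtr ?sum_sqr_ge0.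
have Et : \sum_(i < m) (y i - z i) ^+ 2 = t ^+ 2 by rewrite sqr_sqrtr ?sum_sqr_ge0.
have CS := sum_cauchy_schwarz (fun i => x i - y i) (fun i => y i - z i).
rewrite (eq_bigr (fun i => (x i - y i) ^+ 2 + (y i - z i) ^+ 2 +
  2 * ((x i - y i) * (y i - z i)))); last by move=> i _; ring.
rewrite !big_split/= -mulr_sumr Es Et; rewrite -/s -/t in CS; nra.
Qed.

(** The factor [m.+1] is cruder than the square root of [m], but it gives a strict inequality and
    covers [m = 0]. *)
Lemma euclid_dist_lt x y (e : R) : 0 < e ->
  (forall a, `|x a - y a| <= e / m.+1%:R) -> euclid_dist x y < e.
Proof.
move=> e0 h; have n0 : 0 < m.+1%:R :> R by [].
rewrite -[ltRHS]ger0_norm ?ltW// -sqrtr_sqr ltr_sqrt ?exprn_gt0//.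
apply: (@le_lt_trans _ _ (\sum_(i < m) (e / m.+1%:R) ^+ 2)).
  apply: ler_sum => i _; rewrite -real_normK ?num_real// lerXn2r ?nnegrE//.
  by rewrite divr_ge0// ltW.
rewrite sumr_const card_ord -[X in X < _]mulr_natl expr_div_n mulrCA.
rewrite gtr_pMr ?exprn_gt0// ltr_pdivrMr ?exprn_gt0// mul1r -natrX ltr_nat.
by rewrite expnS expn1; apply: (@leq_trans (m.+1 * 1)); rewrite ?leq_pmul2l ?muln1.
Qed.

Lemma eps_nbhd_open B e : euclid_open (eps_nbhd B e).
Proof.
move=> x [y By xy]; exists (e - euclid_dist x y); first by rewrite subr_gt0.
move=> z; rewrite ltrBrDl => xz; exists y => //.
apply: le_lt_trans (euclid_dist_triangle _ x _) _.
rewrite addrC (_ : euclid_dist z x = euclid_dist x z)//.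
by congr Num.sqrt; apply: eq_bigr => i _; ring.
Qed.

Lemma borel_open B : euclid_open B -> borel_Rm B.
Proof. by move=> oB; apply: sub_sigma_algebra. Qed.

Lemma eps_nbhd_borel B e : borel_Rm (eps_nbhd B e).
Proof. by apply: borel_open; exact: eps_nbhd_open. Qed.

Lemma eps_nbhdD B e e' : eps_nbhd (eps_nbhd B e) e' `<=` eps_nbhd B (e + e').
Proof.
move=> x [y [z Bz yz] xy]; exists z => //.
by apply: le_lt_trans (euclid_dist_triangle x y z) _; rewrite addrC ltrD.
Qed.

Lemma sub_eps_nbhd B e e' : e <= e' -> eps_nbhd B e `<=` eps_nbhd B e'.
Proof. by move=> ee' x [y By xy]; exists y => //; exact: lt_le_trans xy ee'. Qed.

End Euclid.

Section LevyProkhorov.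
Variables (R : realType) (m : nat).
Implicit Types (lam mu rho : law R m) (e : R) (X Y Z : set (law R m)).

(** A [law] is an arbitrary function of sets. These two properties of probability measures are
    enough to bound the distance by 1 and to prove the triangle inequality. *)
Definition monotone_law mu : Prop :=
  (forall B, borel_Rm B -> 0 <= mu B <= 1) /\
  (forall B B', borel_Rm B -> borel_Rm B' -> B `<=` B' -> mu B <= mu B').

Definition LP_close mu rho e := forall B, borel_Rm B ->
  mu B <= rho (eps_nbhd B e) + e /\ rho B <= mu (eps_nbhd B e) + e.

Lemma LP_lbound mu rho : has_lbound [set e : R | 0 < e /\ LP_close mu rho e].
Proof. by exists 0 => e [/ltW]. Qed.

Lemma LP_close_sym mu rho e : LP_close mu rho e -> LP_close rho mu e.
Proof. by move=> h B /h[]. Qed.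

Lemma LP_le mu rho e : 0 < e -> LP_close mu rho e -> LP_dist mu rho <= e.
Proof. by move=> e0 h; apply: ge_inf => //; exact: LP_lbound. Qed.

Lemma LP_distC mu rho : LP_dist mu rho = LP_dist rho mu.
Proof.
by congr inf; apply/seteqP; split=> e [e0 /LP_close_sym].
Qed.

Lemma LP_ge0 mu rho : 0 <= LP_dist mu rho.
Proof.
rewrite /LP_dist; set E := [set _ | _]; have [->|/set0P E0] := eqVneq E set0.
  by rewrite inf0.
by apply: lb_le_inf => // e [/ltW].
Qed.

Lemma LP_close1 mu rho : monotone_law mu -> monotone_law rho -> LP_close mu rho 1.
Proof.
move=> [mu1 _] [rho1 _] B bB.
have := mu1 _ bB; have := rho1 _ bB.
have := mu1 _ (eps_nbhd_borel B 1); have := rho1 _ (eps_nbhd_borel B 1); lra.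
Qed.

Lemma LP_le1 mu rho : monotone_law mu -> monotone_law rho -> LP_dist mu rho <= 1.
Proof. by move=> hm hr; apply: LP_le => //; exact: LP_close1. Qed.

Lemma LP_lt mu rho e : monotone_law mu -> monotone_law rho -> LP_dist mu rho < e ->
  0 < e /\ LP_close mu rho e.
Proof.
move=> hm hr /inf_lt[]; first by exists 1; split=> //; exact: LP_close1.
move=> e' [e'0 h] e'e; split; first exact: lt_trans e'e.
move=> B bB; have [h1 h2] := h B bB.
have sub := sub_eps_nbhd (B := B) (ltW e'e).
have := hm.2 _ _ (eps_nbhd_borel B e') (eps_nbhd_borel B e) sub.
have := hr.2 _ _ (eps_nbhd_borel B e') (eps_nbhd_borel B e) sub.
by lra.
Qed.

Lemma LP_triangle lam mu rho e e' : monotone_law lam -> monotone_law mu ->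
  monotone_law rho -> LP_dist lam mu < e -> LP_dist mu rho < e' ->
  LP_dist lam rho <= e + e'.
Proof.
move=> hl hm hr /LP_lt[]// e0 h /LP_lt[]// e'0 h'.
apply: LP_le; first exact: addr_gt0.
move=> B bB; split.
  have [h1 _] := h B bB; have [h2 _] := h' _ (eps_nbhd_borel B e).
  have := hr.2 _ _ (eps_nbhd_borel (eps_nbhd B e) e') (eps_nbhd_borel B (e + e'))
    (eps_nbhdD (B := B) (e := e) (e' := e')).
  by lra.
have [_ h1] := h' B bB; have [_ h2] := h _ (eps_nbhd_borel B e').
have := hl.2 _ _ (eps_nbhd_borel (eps_nbhd B e') e) (eps_nbhd_borel B (e' + e))
  (eps_nbhdD (B := B) (e := e') (e' := e)).
by rewrite (addrC e'); lra.
Qed.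

(** Guards against the default values of [inf] and [sup]: the infima run over nonempty sets, and the
    suprema over nonempty sets bounded by 1. *)
Definition law_set X := X !=set0 /\ forall lam, X lam -> monotone_law lam.

Lemma inf_LP_le (f : law R m -> R) Y mu : Y mu -> (forall rho, 0 <= f rho) ->
  inf [set f y | y in Y] <= f mu.
Proof. by move=> Ym f0; apply: ge_inf; [exists 0 => _ [y _ <-]|exists mu]. Qed.

Lemma hausdorffC X Y : hausdorff X Y = hausdorff Y X.
Proof.
rewrite /hausdorff maxC; congr (Num.max (sup _) (sup _)).
  apply/seteqP; split=> r [y Yy ->]; exists y => //; congr inf; apply/seteqP; split=> s [x Xx <-];
  by exists x => //; rewrite LP_distC.
apply/seteqP; split=> r [y Yy ->]; exists y => //; congr inf; apply/seteqP; split=> s [x Xx <-];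
by exists x => //; rewrite LP_distC.
Qed.

Lemma hausdorff_le X Y e : X !=set0 -> Y !=set0 ->
  (forall x, X x -> exists2 y, Y y & LP_dist x y <= e) ->
  (forall y, Y y -> exists2 x, X x & LP_dist x y <= e) -> hausdorff X Y <= e.
Proof.
move=> [x0 Xx0] [y0 Yy0] hX hY; rewrite /hausdorff ge_max; apply/andP; split.
  apply: ge_sup; first by exists (inf [set LP_dist x0 y | y in Y]); exists x0.
  move=> _ [x Xx ->]; have [y Yy xy] := hX x Xx; apply: le_trans xy.
  by apply: (inf_LP_le (f := LP_dist x)) => // rho; exact: LP_ge0.
apply: ge_sup; first by exists (inf [set LP_dist x y0 | x in X]); exists y0.
move=> _ [y Yy ->]; have [x Xx xy] := hY y Yy; apply: le_trans xy.
exact: (inf_LP_le (f := fun x => LP_dist x y) Xx (fun r => LP_ge0 _ _)).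
Qed.

Lemma hausdorff_ltl X Y e : law_set X -> law_set Y -> hausdorff X Y < e ->
  forall x, X x -> exists2 y, Y y & LP_dist x y < e.
Proof.
move=> [_ lX] [[y0 Yy0] lY]; rewrite /hausdorff gt_max => /andP[he _] x Xx.
have : inf [set LP_dist x y | y in Y] < e.
  apply: le_lt_trans he; apply: ub_le_sup; last by exists x.
  exists 1 => _ [x' Xx' ->]; apply: le_trans (LP_le1 (lX _ Xx') (lY _ Yy0)).
  by apply: (inf_LP_le (f := LP_dist x')) => // rho; exact: LP_ge0.
move=> /inf_lt[]; first by exists (LP_dist x y0); exists y0.
by move=> _ [y Yy <-] xy; exists y.
Qed.

Lemma hausdorff_triangle X Y Z e e' : law_set X -> law_set Y -> law_set Z ->
  hausdorff X Y < e -> hausdorff Y Z < e' -> hausdorff X Z <= e + e'.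
Proof.
move=> lX lY lZ hXY hYZ; apply: hausdorff_le; [exact: lX.1|exact: lZ.1| |].
  move=> x Xx; have [y Yy xy] := hausdorff_ltl lX lY hXY Xx.
  have [z Zz yz] := hausdorff_ltl lY lZ hYZ Yy; exists z => //.
  by apply: LP_triangle xy yz; [exact: lX.2|exact: lY.2|exact: lZ.2].
rewrite hausdorffC in hXY; rewrite hausdorffC in hYZ.
move=> z Zz; have [y Yy zy] := hausdorff_ltl lZ lY hYZ Zz.
have [x Xx yx] := hausdorff_ltl lY lX hXY Yy; exists x => //.
rewrite LP_distC addrC.
by apply: LP_triangle zy yx; [exact: lZ.2|exact: lY.2|exact: lX.2].
Qed.

Lemma hausdorff_le1 X Y : law_set X -> law_set Y -> hausdorff X Y <= 1.
Proof.
move=> [[x0 Xx0] lX] [[y0 Yy0] lY]; apply: hausdorff_le.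
- by exists x0.
- by exists y0.
- by move=> x Xx; exists y0 => //; apply: LP_le1; [exact: lX|exact: lY].
- by move=> y Yy; exists x0 => //; apply: LP_le1; [exact: lX|exact: lY].
Qed.

Lemma hausdorff_ge0 X Y : law_set X -> law_set Y -> 0 <= hausdorff X Y.
Proof.
move=> [[x0 Xx0] lX] [[y0 Yy0] lY]; rewrite /hausdorff le_max; apply/orP; left.
apply: (@le_trans _ _ (inf [set LP_dist x0 y | y in Y])).
  by apply: lb_le_inf => [|_ [y _ <-]]; [exists (LP_dist x0 y0); exists y0|exact: LP_ge0].
apply: ub_le_sup; last by exists x0.
exists 1 => _ [x' Xx' ->]; apply: le_trans (LP_le1 (lX _ Xx') (lY _ Yy0)).
by apply: (inf_LP_le (f := LP_dist x')) => // rho; exact: LP_ge0.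
Qed.

(* [mass J] sandwiches [lam] up to moving points by [eta]: the part of [lam]
   in cell [c] lives within [eta] (in sup norm) of the centre [z c]. *)
Definition cell_mass (K : finType) (z : K -> 'I_m -> R) (eta : R) lam
    (mass : {set K} -> R) : Prop :=
  (forall B (J : {set K}), borel_Rm B ->
    (forall c y, B y -> (forall a, `|y a - z c a| <= eta) -> c \in J) ->
    lam B <= mass J) /\
  (forall B (J : {set K}), borel_Rm B ->
    (forall c y, c \in J -> (forall a, `|y a - z c a| <= eta) -> B y) ->
    mass J <= lam B).

(** Let [J] be the cells whose [eta]-ball meets [B]. Then [lam B] is at most [mass J], hence at most
    [mass' J + e], and every point near a centre of [J] is within [eta + eta] of [B] in each
    coordinate, so [mass' J] is at most the [lam']-mass of the [e]-neighbourhood. *)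
Lemma cell_mass_LP (K : finType) (z : K -> 'I_m -> R) (eta e : R) lam lam' mass mass' :
  cell_mass z eta lam mass -> cell_mass z eta lam' mass' -> 0 < e ->
  eta + eta <= e / m.+1%:R -> (forall J, `|mass J - mass' J| <= e) ->
  LP_dist lam lam' <= e.
Proof.
move=> h h' e0 etae mm; apply: LP_le => // B bB.
pose J := [set c : K | `[< exists2 y, B y & forall a, `|y a - z c a| <= eta >]]%SET.
have JB c y : B y -> (forall a, `|y a - z c a| <= eta) -> c \in J.
  by move=> By yc; rewrite inE; apply/asboolP; exists y.
have JBe c y : c \in J -> (forall a, `|y a - z c a| <= eta) -> eps_nbhd B e y.
  rewrite inE => /asboolP[y' By' y'c] yc; exists y' => //.
  apply: euclid_dist_lt => // a; apply: le_trans etae.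
  apply: le_trans (ler_distD (z c a) _ _) _; apply: lerD => //.
  by rewrite distrC.
have := h.1 _ _ bB JB; have := h'.1 _ _ bB JB.
have := h.2 _ _ (eps_nbhd_borel B e) JBe; have := h'.2 _ _ (eps_nbhd_borel B e) JBe.
by have := mm J; rewrite ler_norml; lra.
Qed.

End LevyProkhorov.

(** * Standard parts and lifts *)

Section Digits.
Variable R : realType.
Implicit Types t e : R.

Definition weight (n : nat) : R := (2 ^+ n)^-1.

(** Remainder after [n] digits of the greedy binary expansion. The number 1 gets the digits
    0.111..., so its remainder equals [weight n], and the bounds in [drem_bound] are closed. *)
Fixpoint drem t n : R :=
  if n is m.+1 then drem t m - (if weight m.+1 <= drem t m then weight m.+1 else 0)
  else t.

Definition digit t n : bool := weight n.+1 <= drem t n.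

Lemma weight_gt0 n : 0 < weight n.
Proof. by rewrite invr_gt0 exprn_gt0. Qed.

Lemma weight0 : weight 0 = 1.
Proof. by rewrite /weight expr0 invr1. Qed.

Lemma weightS n : weight n = weight n.+1 + weight n.+1.
Proof.
rewrite /weight exprS; have : 2 ^+ n != 0 :> R by rewrite expf_neq0.
by move=> h; field.
Qed.

Lemma weight_lt e : 0 < e -> exists n, weight n < e.
Proof.
move=> e0; exists (Num.truncn e^-1).+1.
rewrite invf_plt ?posrE ?exprn_gt0//; apply: lt_trans (Num.Theory.truncnS_gt _) _.
by rewrite -natrX ltr_nat ltn_expl.
Qed.

Lemma weight_le0 e : (forall n, e <= weight n) -> e <= 0.
Proof.
move=> h; rewrite leNgt; apply/negP => /weight_lt[n].
by rewrite ltNge h.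
Qed.

Lemma digit_sum t n :
  t = \sum_(k < n) weight k.+1 * (digit t k)%:R + drem t n.
Proof.
elim: n => [|n IH]; first by rewrite big_ord0 add0r.
rewrite big_ord_recr/= {1}IH /digit; case: ifP => _; rewrite ?mulr1 ?mulr0; lra.
Qed.

Lemma drem_bound t n : 0 <= t <= 1 -> 0 <= drem t n <= weight n.
Proof.
move=> t01; elim: n => [|n IH] /=; first by rewrite /weight expr0 invr1.
by have := weightS n; case: (leP (weight n.+1) (drem t n)) => h; lra.
Qed.

Lemma weight_sum (b : nat -> bool) n m :
  0 <= \sum_(n <= k < n + m) weight k.+1 * (b k)%:R <= weight n - weight (n + m).
Proof.
elim: m => [|m IH]; first by rewrite addn0 big_geq// subrr lexx.
rewrite addnS big_nat_recr ?leq_addr//= .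
have := weightS (n + m); have := weight_gt0 (n + m).+1.
by case: (b _); rewrite ?mulr1 ?mulr0; lra.
Qed.

Context d (T : measurableType d).

Lemma measurable_drem (f : T -> R) n : measurable_fun setT f ->
  measurable_fun setT (fun x => drem (f x) n).
Proof.
move=> mf; elim: n => [//|n IH] /=; apply: measurable_funB => //.
apply: measurable_fun_ifT => //; apply: (measurable_fun_bool true).
exact: measurable_fun_le.
Qed.

Lemma measurable_digit (f : T -> R) n : measurable_fun setT f ->
  measurable [set x | digit (f x) n].
Proof.
move=> mf; rewrite -[X in measurable X]setTI.
by apply: measurable_fun_le => //; exact: measurable_drem.
Qed.

End Digits.

(** * Standard parts: measurability, integrals and lifts *)

Section StandardPart.
Variables (R : realType) (W : nat -> fprob R).
Local Notation P := (@lprob R W).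
Definition ifun := forall i, W i -> R.
Implicit Types F H : ifun.

Definition ibnd (C : R) F := forall i x, `|F i x| <= C.

Definition st F (x : loeb W) : R := ulim (fun i => F i (x i)).

Lemma stP C F : ibnd C F -> forall x : loeb W, (fun i => F i (x i)) @ fultra --> st F x.
Proof. by move=> FC x; apply: (@ulimP _ _ C) => i; exact: FC. Qed.
Arguments stP : clear implicits.

Lemma ifexp_cvg C F : ibnd C F ->
  (fun i => fexp (F i)) @ fultra --> ulim (fun i => fexp (F i)).
Proof. by move=> FC; apply: (@ulimP _ _ C) => i; apply: fexp_bound; exact: FC. Qed.
Arguments ifexp_cvg : clear implicits.

Lemma ibnd_ge0 C F : ibnd C F -> 0 <= C.
Proof. by move=> FC; apply: le_trans (FC 0%N (loeb_point W 0%N)); rewrite normr_ge0. Qed.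

Lemma ibndD C C' F H : ibnd C F -> ibnd C' H -> ibnd (C + C') (fun i x => F i x + H i x).
Proof. by move=> FC HC i x; apply: le_trans (ler_normD _ _) (lerD (FC i x) (HC i x)). Qed.

Lemma ibndZ C F a : ibnd C F -> ibnd (`|a| * C) (fun i x => a * F i x).
Proof. by move=> FC i x; rewrite normrM ler_wpM2l. Qed.

Lemma ibndM C C' F H : ibnd C F -> ibnd C' H -> ibnd (C * C') (fun i x => F i x * H i x).
Proof. by move=> FC HC i x; rewrite normrM ler_pM. Qed.

Lemma ibnd_norm C F : ibnd C F -> ibnd C (fun i x => `|F i x|).
Proof. by move=> FC i x; rewrite normr_id. Qed.

Lemma ibnd_cst a : ibnd `|a| (fun _ _ => a).
Proof. by []. Qed.

Lemma stD C C' F H : ibnd C F -> ibnd C' H ->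
  forall x, st (fun i x => F i x + H i x) x = st F x + st H x.
Proof. by move=> FC HC x; apply: ulim_eq; apply: cvgD; [exact: stP FC _|exact: stP HC _]. Qed.

Lemma stM C C' F H : ibnd C F -> ibnd C' H ->
  forall x, st (fun i x => F i x * H i x) x = st F x * st H x.
Proof. by move=> FC HC x; apply: ulim_eq; apply: cvgM; [exact: stP FC _|exact: stP HC _]. Qed.

Lemma stZ C F a : ibnd C F -> forall x, st (fun i x => a * F i x) x = a * st F x.
Proof. by move=> FC x; apply: ulim_eq; apply: cvgMr; exact: stP FC _. Qed.

Lemma st_norm C F : ibnd C F -> forall x, st (fun i x => `|F i x|) x = `|st F x|.
Proof. by move=> FC x; apply: ulim_eq; apply: cvg_norm; exact: stP FC _. Qed.

Lemma st_cst a x : st (fun _ _ => a) x = a.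
Proof. by apply: ulim_eq; exact: cvg_cst. Qed.

Lemma le_st C C' F H : ibnd C F -> ibnd C' H -> (forall i x, F i x <= H i x) ->
  forall x, st F x <= st H x.
Proof.
move=> FC HC FH x; apply: (ultra_le (stP _ _ FC x) (stP _ _ HC x)).
by apply: filterE => i.
Qed.

Lemma st_bound C F : ibnd C F -> forall x, `|st F x| <= C.
Proof.
move=> FC x; rewrite -(st_norm FC) -[leRHS](st_cst _ x).
by apply: le_st (ibnd_norm FC) (ibnd_cst _) _ x => i y; exact: FC.
Qed.

(** Where [e / 2 <= |F i|] almost always, the standard part is nonzero, so this internal set has
    mass 0; the bound [C] turns small probability into small mean. The divisor is [C + 1] because
    [C] may be 0. *)
Lemma st_null_fexp C F : ibnd C F -> lnull [set x | st F x <> 0] ->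
  (fun i => fexp (fun x => `|F i x|)) @ fultra --> (0 : R).
Proof.
move=> FC F0; have C0 := ibnd_ge0 FC; apply: ultra_cvgP => e e0.
pose S : isets W := fun i x => e / 2 <= `|F i x|.
have S0 : imass S = 0.
  apply/lnull_iset; apply: sub_lnull F0 => x Sx /= Fx.
  have := ultra_near_dist (stP _ _ FC x) (e := e / 2) (divr_gt0 e0 (ltr0Sn _ _)).
  move=> h; have [i []] := fultra_ex2 Sx h.
  by rewrite /S Fx subr0 => /le_lt_trans h' /h'; rewrite ltxx.
have e'0 : 0 < e / 2 / (C + 1) by rewrite !divr_gt0// ltr_wpDl.
apply: filterS (ultra_near_dist (imass_cvg S) e'0) => i.
rewrite S0 !subr0 ger0_norm ?fpr_ge0// => Si.
rewrite ger0_norm; last by apply: sumr_ge0 => x _; rewrite mulr_ge0// fmass_ge0.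
apply: (@le_trans _ _ (fexp (fun x : W i => e / 2 + C * (S i x)%:R))).
  apply: le_fexp => x; rewrite /S; case: (leP (e / 2)) => [_|/ltW h].
    by rewrite mulr1; apply: le_trans (FC i x) _; rewrite lerDr divr_ge0// ltW.
  by rewrite mulr0 addr0.
rewrite fexpD fexp_cst fexpZ -/(fpr _).
suff : C * fpr (S i) <= e / 2 by lra.
apply: (@le_trans _ _ ((C + 1) * (e / 2 / (C + 1)))).
  by apply: ler_pM; rewrite ?fpr_ge0// ?lerDl ?ltW.
by rewrite mulrC divfK// gt_eqF// ltr_wpDl.
Qed.

(** Markov's inequality at each threshold [weight R n], followed by a countable union of null
    sets. *)
Lemma fexp_st_null C F : ibnd C F ->
  (fun i => fexp (fun x => `|F i x|)) @ fultra --> (0 : R) ->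
  lnull [set x | st F x <> 0].
Proof.
move=> FC F0; pose S n : isets W := fun i x => weight R n <= `|F i x|.
apply: (@sub_lnull _ _ _ (\bigcup_n iset (S n))); last first.
  apply: lnull_bigcup => n; apply/lnull_iset/eqP; rewrite eq_le imass_ge0 andbT.
  have F0' : (fun i => 2 ^+ n * fexp (fun x => `|F i x|)) @ fultra --> (0 : R).
    by rewrite -[X in _ --> X](mulr0 (2 ^+ n)); exact: cvgMl_tmp F0.
  apply: (ultra_le (imass_cvg (S n)) F0').
  apply: filterE => i; rewrite -fexpZ; apply: le_fexp => x; rewrite /S /=.
  have h : 0 < 2 ^+ n :> R by rewrite exprn_gt0.
  case: (leP (weight R n)) => [|_]; last by rewrite mulr_ge0// ltW.
  by rewrite /weight -(ler_pM2l h) divff// gt_eqF.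
move=> x /= /eqP; rewrite -normr_gt0 => /weight_lt[n nx]; exists n => //.
rewrite -(st_norm FC) in nx.
have := ultra_near_dist (stP _ _ (ibnd_norm FC) x) (e := st (fun i x => `|F i x|) x - weight R n).
rewrite subr_gt0 => /(_ nx); apply: filterS => i; rewrite ltr_norml => /andP[h _].
by rewrite /S; lra.
Qed.

(** The digits are those of [F i], not of [st F], because their level sets are internal. Near a
    dyadic point the two expansions may differ, yet the truncated values still approximate [st F]
    within [weight R n]. *)
Definition dsum F n (x : loeb W) : R :=
  \sum_(k < n) weight R k.+1 * \1_(iset (fun i y => digit (F i y) k)) x.

Lemma dsum_approx F n x : (forall i x, 0 <= F i x <= 1) ->
  dsum F n x <= st F x <= dsum F n x + weight R n.
Proof.
move=> F01; have FC : ibnd 1 F by move=> i y; rewrite ger0_norm; case/andP: (F01 i y).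
have h : \forall i \near fultra, forall k : 'I_n,
    (digit (F i (x i)) k)%:R = \1_(iset (fun i y => digit (F i y) k)) x :> R.
  apply: filter_forall => k; rewrite indicE.
  have [h|h] := fultra_dec (fun i => digit (F i (x i)) k).
    by rewrite mem_set//; apply: filterS h => i ->.
  rewrite memNset; first by apply: filterS h => i /negP/negbTE ->.
  by move=> h'; have [i []] := fultra_ex2 h h'.
have {}h : \forall i \near fultra, dsum F n x <= F i (x i) <= dsum F n x + weight R n.
  apply: filterS h => i h; have /(drem_bound n) := F01 i (x i).
  rewrite {3 4}(digit_sum (F i (x i)) n); under eq_bigr do rewrite h.
  by rewrite -/(dsum _ _ _); lra.
apply/andP; split.
  by apply: (ultra_le (cvg_cst _) (stP _ _ FC x)); apply: filterS h => i /andP[].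
by apply: (ultra_le (stP _ _ FC x) (cvg_cst _)); apply: filterS h => i /andP[].
Qed.

Lemma measurable_dsum F n : measurable_fun setT (dsum F n).
Proof.
apply: measurable_sum => k; apply: measurable_funM => //.
by apply: measurable_indic; exact: measurable_iset.
Qed.

Lemma measurable_st01 F : (forall i x, 0 <= F i x <= 1) -> measurable_fun setT (st F).
Proof.
move=> F01; apply: (@measurable_fun_cvg _ _ _ _ (dsum F)) => [n|x _].
  exact: measurable_dsum.
apply/cvgrPdist_le => e e0; have [N Ne] := weight_lt e0.
exists N => // n /= Nn; have := dsum_approx n x F01.
have : weight R n <= weight R N.
  by rewrite /weight lef_pV2 ?posrE ?exprn_gt0// ler_eXn2l ?ltr1n.
by rewrite ler_distl; lra.
Qed.

Lemma integral_lcst (a : R) : (\int[P]_x a%:E = a%:E)%E.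
Proof.
rewrite integral_cst//; transitivity (a%:E * 1)%E; last by rewrite mule1.
by congr (_ * _)%E; exact: lprobT.
Qed.

Lemma integral_st01 F : (forall i x, 0 <= F i x <= 1) ->
  (\int[P]_x (st F x)%:E = (ulim (fun i => fexp (F i)))%:E)%E.
Proof.
move=> F01; have FC : ibnd 1 F by move=> i y; rewrite ger0_norm; case/andP: (F01 i y).
(* [s n] is both the integral of [dsum F n] and the limit of the means of the truncated expansions,
   so both sides of the claim lie between [s n] and [s n + weight R n]. *)
pose s n := \sum_(k < n) weight R k.+1 * imass (fun i y => digit (F i y) k).
have w0 n := ltW (weight_gt0 R n).
have ds0 n x : 0 <= dsum F n x by apply: sumr_ge0 => k _; rewrite mulr_ge0.
have intd n : (\int[P]_x (dsum F n x)%:E = (s n)%:E)%E.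
  under eq_integral do rewrite -sumEFin.
  rewrite ge0_integral_sum//; last 2 first.
  - move=> k; apply/measurable_EFinP; apply: measurable_funM => //.
    by apply: measurable_indic; exact: measurable_iset.
  - by move=> k x _; rewrite lee_fin mulr_ge0.
  rewrite /s -sumEFin; apply: eq_bigr => k _.
  under eq_integral do rewrite EFinM.
  rewrite ge0_integralZl_EFin//.
  - rewrite EFinM; congr (_ * _)%E; rewrite integral_indic ?setIT//.
      exact: lprob_iset.
    exact: measurable_iset.
  - by apply/measurable_EFinP; apply: measurable_indic; exact: measurable_iset.
have sJ n : s n <= ulim (fun i => fexp (F i)) <= s n + weight R n.
  have sc : (fun i => \sum_(k < n) weight R k.+1 * fpr (fun y : W i => digit (F i y) k))
      @ fultra --> s n.
    by apply: ultra_cvg_sum => k; apply: cvgMl_tmp; exact: imass_cvg.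
  have h i : \sum_(k < n) weight R k.+1 * fpr (fun y : W i => digit (F i y) k) <=
      fexp (F i) <= \sum_(k < n) weight R k.+1 * fpr (fun y : W i => digit (F i y) k) + weight R n.
    under eq_bigr do rewrite -fexpZ.
    rewrite -fexp_sum -[weight R n](fexp_cst (W i)) -fexpD; apply/andP; split.
      apply: le_fexp => x; rewrite [leRHS](digit_sum _ n).
      by have /(drem_bound n)/andP[] := F01 i x; lra.
    apply: le_fexp => x; rewrite [leLHS](digit_sum _ n).
    by have /(drem_bound n)/andP[] := F01 i x; lra.
  apply/andP; split.
    apply: (ultra_le sc (ifexp_cvg _ _ FC)); apply: filterE => i; by case/andP: (h i).
  apply: (ultra_le (ifexp_cvg _ _ FC) (cvgD sc (cvg_cst _))).
  apply: filterE => i; by case/andP: (h i).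
have mst := measurable_st01 F01.
have st0 x : 0 <= st F x.
  by have /andP[+ _] := dsum_approx 0 x F01; rewrite /dsum big_ord0.
have Il n : ((s n)%:E <= \int[P]_x (st F x)%:E)%E.
  rewrite -intd; apply: ge0_le_integral => //.
  - by move=> x _; rewrite lee_fin.
  - by apply/measurable_EFinP; exact: measurable_dsum.
  - exact/measurable_EFinP.
  - by move=> x _; rewrite lee_fin; have /andP[] := dsum_approx n x F01.
have Iu n : (\int[P]_x (st F x)%:E <= (s n + weight R n)%:E)%E.
  apply: (@le_trans _ _ (\int[P]_x ((dsum F n x)%:E + (weight R n)%:E)))%E.
    apply: ge0_le_integral => //.
    - by move=> x _; rewrite lee_fin.
    - exact/measurable_EFinP.
    - apply/measurable_EFinP; apply: measurable_funD => //; exact: measurable_dsum.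
    - by move=> x _; rewrite -EFinD lee_fin; have /andP[] := dsum_approx n x F01.
  rewrite ge0_integralD//.
  - by rewrite intd integral_lcst.
  - by move=> x _; rewrite lee_fin.
  - by apply/measurable_EFinP; exact: measurable_dsum.
  - by move=> x _; rewrite lee_fin.
have : (\int[P]_x (st F x)%:E)%E \is a fin_num.
  rewrite ge0_fin_numE; first exact: le_lt_trans (Iu 0%N) (ltry _).
  by apply: integral_ge0 => x _; rewrite lee_fin.
move=> /fineK E; rewrite -E; congr EFin.
apply/eqP; rewrite eq_le -[X in X && _]subr_le0 -[X in _ && X]subr_le0.
set r := fine _ in E *.
have {}Il n : s n <= r by rewrite -lee_fin E.
have {}Iu n : r <= s n + weight R n by rewrite -lee_fin E.
by apply/andP; split; apply: weight_le0 => n; have := sJ n; have := Il n; have := Iu n; lra.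
Qed.

Lemma ibnd01 C F : ibnd C F -> exists2 H : ifun, (forall i x, 0 <= H i x <= 1) &
  F = (fun i x => (C + 1) * (2 * H i x + -1)).
Proof.
move=> FC; have C0 := ibnd_ge0 FC; have C1 : 0 < C + 1 by rewrite ltr_wpDl.
exists (fun i x => (F i x / (C + 1) + 1) / 2).
  move=> i x; have : -1 <= F i x / (C + 1) <= 1; last lra.
  by rewrite -ler_norml normrM (gtr0_norm (_ : 0 < _^-1)) ?invr_gt0// ler_pdivrMr// mul1r
    (le_trans (FC i x))// lerDl.
apply: functional_extensionality_dep => i; apply/funext => x.
by field; rewrite gt_eqF.
Qed.

Lemma st_affine (H : ifun) a : (forall i x, 0 <= H i x <= 1) ->
  forall x, st (fun i x => a * (2 * H i x + -1)) x = a * (2 * st H x + -1).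
Proof.
move=> H01 x; have HC : ibnd 1 H by move=> i y; rewrite ger0_norm; case/andP: (H01 i y).
rewrite (stZ _ (ibndD (ibndZ 2 HC) (ibnd_cst (-1)))); congr (_ * _).
by rewrite (stD (ibndZ 2 HC) (ibnd_cst (-1))) (stZ _ HC) st_cst.
Qed.

Lemma measurable_st C F : ibnd C F -> measurable_fun setT (st F).
Proof.
move=> /ibnd01[H H01 ->]; rewrite (_ : st _ = fun x => (C + 1) * (2 * st H x + -1)).
  apply: measurable_funM => //; apply: measurable_funD => //.
  by apply: measurable_funM => //; exact: measurable_st01.
by apply/funext => x; exact: st_affine.
Qed.

Lemma bounded_integrable (f : loeb W -> R) C : measurable_fun setT f ->
  (forall x, `|f x| <= C) -> P.-integrable setT (EFin \o f).
Proof.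
move=> mf fC; apply: measurable_bounded_integrable => //.
  by rewrite (le_lt_trans (probability_le1 P measurableT))// ltry.
by exists C; split; [exact: num_real|move=> M CM x _ /=; exact: le_trans (fC x) (ltW CM)].
Qed.

Lemma integrable_st C F : ibnd C F -> P.-integrable setT (EFin \o st F).
Proof. by move=> FC; apply: (bounded_integrable (measurable_st FC) (st_bound FC)). Qed.

Lemma integral_st C F : ibnd C F ->
  (\int[P]_x (st F x)%:E = (ulim (fun i => fexp (F i)))%:E)%E.
Proof.
move=> /ibnd01[H H01 ->]; have HC : ibnd 1 H by move=> i y; rewrite ger0_norm; case/andP: (H01 i y).
under eq_integral do rewrite st_affine// mulrDr mulrA EFinD EFinM.
rewrite integralD_EFin => //.
- rewrite [X in (X + _)%E](_ : _ = \int[P]_x (((C + 1) * 2)%:E * (EFin \o st H) x))%E; last by [].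
  rewrite integralZl//=; last exact: integrable_st HC.
  rewrite integral_st01// integral_lcst -EFinM -EFinD; congr EFin.
  apply/esym/ulim_eq; rewrite (_ : (fun i => _) =
     fun i => (C + 1) * 2 * fexp (H i) + (C + 1) * -1).
    by apply: cvgD; [apply: cvgMr; exact: ifexp_cvg HC|exact: cvg_cst].
  by apply/funext => i; rewrite fexpZ fexpD fexpZ fexp_cst; ring.
- by apply: (integrableZl _ ((C + 1) * 2) (integrable_st HC)).
- exact: (bounded_integrable (C := `|(C + 1) * -1|)).
Qed.

Definition slift (v : loeb W -> R) F : Prop :=
  (exists C, ibnd C F) /\ {ae P, forall x, st F x = v x}.

Lemma lift01 (f : loeb W -> R) : measurable_fun setT f -> (forall x, 0 <= f x <= 1) ->
  exists2 F : ifun, (forall i x, 0 <= F i x <= 1) & {ae P, forall x, st F x = f x}.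
Proof.
move=> mf f01.
have /choice[S SP] k : lmeas [set x | digit (f x) k] by exact: measurable_digit mf.
(* The number of digits grows with the factor, so every digit of [f x] enters the limit; whatever
   the [S k] are, the digits beyond [N] contribute at most [weight R N]. *)
pose F : ifun := fun i x => \sum_(0 <= k < i) weight R k.+1 * (S k i x)%:R.
have F01 i x : 0 <= F i x <= 1.
  have := weight_sum R (fun k => S k i x) 0 i; have := weight_gt0 R i.
  by rewrite /F add0n weight0; lra.
exists F => //; apply/lprob_aeP; apply: sub_lnull (lnull_bigcup SP) => x /= nFx.
apply: contrapT => nS; apply: nFx.
have {nS} SE k : digit (f x) k <-> iset (S k) x.
  by apply: contrapT => h; apply: nS; exists k.
apply: ulim_eq; apply: ultra_cvgP => e e0; have [N Ne] := weight_lt e0.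
have hk : \forall i \near fultra, forall k : 'I_N, S k i (x i) = digit (f x) k.
  apply: filter_forall => k; have [d|d] := boolP (digit (f x) k).
    by move/SE : d; apply: filterS => i ->.
  have : ~ iset (S k) x by move/SE; apply/negP.
  by move/fultra_not; apply: filterS => i /negP/negbTE.
have hN : \forall i \near fultra, (N <= i)%N by apply: fultra_oo; exact: nbhs_infty_ge.
apply: filterS2 hk hN => i hk Ni.
have := weight_sum R (fun k => S k i (x i)) N (i - N); rewrite subnKC// => tl.
rewrite /F (@big_cat_nat _ _ _ N 0 i)//= big_mkord.
rewrite (eq_bigr (fun k : 'I_N => weight R k.+1 * (digit (f x) k)%:R)); last first.
  by move=> k _; rewrite hk.
have := drem_bound N (f01 x); have := digit_sum (f x) N.
by have := weight_gt0 R i; rewrite ler_distl; lra.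
Qed.

(** The bound on [f] holds almost everywhere only, so [f] is first truncated. Keeping the exact
    constant [c] matters: with [c = 1] the lifts are admissible test functions on the vertices. *)
Lemma lift_bound (f : loeb W -> R) (c : R) : measurable_fun setT f -> 0 < c ->
  {ae P, forall x, `|f x| <= c} ->
  exists2 F : ifun, ibnd c F & {ae P, forall x, st F x = f x}.
Proof.
move=> mf c0 fc.
pose g x := (Num.max (-1) (Num.min 1 (f x / c)) + 1) / 2.
have mg : measurable_fun setT g.
  apply: measurable_funM => //; apply: measurable_funD => //.
  apply: measurable_maxr => //; apply: measurable_minr => //.
  exact: measurable_funM.
have [|F F01 Fg] := lift01 mg.
  move=> x; rewrite /g; have : -1 <= Num.max (-1) (Num.min 1 (f x / c)) <= 1.
    by rewrite le_max lexx/= ge_max ge_min lexx/= andbT; lra.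
  by lra.
exists (fun i x => c * (2 * F i x + -1)).
  move=> i x; rewrite normrM (gtr0_norm c0) -[leRHS]mulr1 ler_pM2l// ler_norml.
  by have := F01 i x; lra.
apply: filterS2 fc Fg => x fc Fg; rewrite st_affine// Fg /g.
have : -1 <= f x / c <= 1.
  by rewrite -ler_norml normrM (gtr0_norm (_ : 0 < c^-1)) ?invr_gt0// ler_pdivrMr// mul1r.
move=> h; have -> : Num.max (-1) (Num.min 1 (f x / c)) = f x / c.
  by rewrite min_r ?max_r; lra.
by field; rewrite gt_eqF.
Qed.

Lemma Linf_lift v : Linf P v -> exists F, slift v F.
Proof.
move=> [mv [c vc]]; have [||F Fc Fv] := @lift_bound v (`|c| + 1) mv.
- by rewrite ltr_wpDl.
- by apply: filterS vc => x; have := ler_norm c; lra.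
by exists F; split => //; exists (`|c| + 1).
Qed.

End StandardPart.
Arguments stP {R W}.
Arguments ifexp_cvg {R W}.

(** * The ultraproduct operator *)

Section UltraOperator.
Variables (R : realType) (W : nat -> fprob R).
Variable M : forall i, (W i -> R) -> W i -> R.
Local Notation P := (@lprob R W).

Hypothesis M_lin : forall i a b (F H : W i -> R) x,
  M (fun y => a * F y + b * H y) x = a * M F x + b * M H x.
Hypothesis M_bnd : forall i (C : R) (F : W i -> R), (forall x, `|F x| <= C) ->
  forall x, `|M F x| <= C.
Hypothesis M_ge0 : forall i (F : W i -> R), (forall x, 0 <= F x) ->
  forall x, 0 <= M F x.
Hypothesis M_sym : forall i (F H : W i -> R),
  fexp (fun x => M F x * H x) = fexp (fun x => M H x * F x).
(** Required in mean only: at an isolated vertex, which has mass 0, the walk operator sends 1 to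
    0. *)
Hypothesis M_one : forall i, fexp (fun x : W i => `|M (fun=> 1) x - 1|) = 0.
Hypothesis M_contr : forall i (F : W i -> R),
  fexp (fun x => `|M F x|) <= fexp (fun x => `|F x|).

Definition imap (F : ifun W) : ifun W := fun i => M (F i).
Arguments imap : clear implicits.

(** The default 0 makes the operator total while every value remains the standard part of a bounded
    internal function, hence measurable and integrable. *)
Definition ulop (v : loeb W -> R) : loeb W -> R :=
  if pselect (exists F, slift v F) is left e then st (imap (sval (cid e)))
  else fun=> 0.

Lemma imap_bnd C F : ibnd C F -> ibnd C (imap F).
Proof. by move=> FC i; apply: M_bnd; exact: FC. Qed.

Lemma ulop_st v : exists C F, ibnd C F /\ ulop v = st F.
Proof.
rewrite /ulop; case: pselect => [e|_].
  case: cid => F [[C FC] _] /=; exists C, (imap F); split=> //; exact: imap_bnd.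
exists 0, (fun _ _ => 0); split; first by move=> i x; rewrite normr0.
by apply/funext => x; rewrite st_cst.
Qed.

(* Two lifts of the same function are close in [L^1], which [M] contracts. *)
Lemma ulopE v F : slift v F -> {ae P, forall x, ulop v x = st (imap F) x}.
Proof.
rewrite /ulop => -[[C FC] Fv]; case: pselect => [e|[]]; last first.
  by exists F; split => //; exists C.
case: cid => F' /= [[C' FC'] Fv'].
pose H : ifun W := fun i x => 1 * F' i x + -1 * F i x.
have HC : ibnd (`|1| * C' + `|-1| * C) H by apply: ibndD; exact: ibndZ.
have stH x : st H x = st F' x - st F x.
  by rewrite (stD (ibndZ 1 FC') (ibndZ (-1) FC)) (stZ _ FC') (stZ _ FC) mul1r mulN1r.
have stMH x : st (imap H) x = st (imap F') x - st (imap F) x.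
  rewrite [imap H](_ : _ = fun i x => 1 * imap F' i x + -1 * imap F i x).
    by rewrite (stD (ibndZ 1 (imap_bnd FC')) (ibndZ (-1) (imap_bnd FC)))
      (stZ _ (imap_bnd FC')) (stZ _ (imap_bnd FC)) mul1r mulN1r.
  by apply: functional_extensionality_dep => i; apply/funext => y; exact: M_lin.
have H0 : lnull [set x | st H x <> 0].
  by apply/lprob_aeP; apply: filterS2 Fv Fv' => x e1 e2; rewrite stH e1 e2 subrr.
have MH0 : (fun i => fexp (fun x => `|imap H i x|)) @ fultra --> (0 : R).
  apply: ultra_cvgP => e0 e00.
  apply: filterS (ultra_near_dist (st_null_fexp HC H0) e00) => i.
  have fge0 (K : W i -> R) : 0 <= fexp (fun x => `|K x|).
    by apply: sumr_ge0 => x _; rewrite mulr_ge0// fmass_ge0.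
  by rewrite !subr0 !ger0_norm// => /ltW; apply: le_trans; exact: M_contr.
have /lprob_aeP := fexp_st_null (imap_bnd HC) MH0.
by apply: filterS => x; rewrite stMH => /subr0_eq.
Qed.

Lemma lift_cst (a : R) : slift (fun=> a) ((fun _ _ => a) : ifun W).
Proof.
split; first by exists `|a|; exact: ibnd_cst.
by apply: aeW => x; exact: st_cst.
Qed.

Lemma ae_norm_le_ge0 (v : loeb W -> R) (c : R) : {ae P, forall x, `|v x| <= c} -> 0 <= c.
Proof.
move=> vc; rewrite leNgt; apply/negP => c0.
have : lnull (iset (fun=> xpredT) : set (loeb W)).
  apply: sub_lnull ((lprob_aeP _).1 vc) => x _ /= vx.
  by have := le_lt_trans (le_trans (normr_ge0 _) vx) c0; rewrite ltxx.
by move/lnull_iset; rewrite imassT => /eqP; rewrite oner_eq0.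
Qed.

Lemma integrable_ulop v : P.-integrable setT (EFin \o ulop v).
Proof. by have [C [F [FC ->]]] := ulop_st v; exact: integrable_st FC. Qed.

Lemma measurable_ulop v : measurable_fun setT (ulop v).
Proof. by have [C [F [FC ->]]] := ulop_st v; exact: measurable_st FC. Qed.

Lemma integral_ulopM v w : Linf P v -> Linf P w -> forall F H, slift v F -> slift w H ->
  (\int[P]_x (ulop v x * w x)%:E =
   (ulim (fun i => fexp (fun x => imap F i x * H i x)))%:E)%E.
Proof.
move=> [mv _] [mw _] F H Fv Hw; have := ulopE Fv.
move: Fv Hw => [[C FC] Fv] [[C' HC] Hw] vF.
have BC := ibndM (imap_bnd FC) HC.
rewrite -(integral_st BC); apply: ae_eq_integral => //.
- by apply/measurable_EFinP; apply: measurable_funM => //; exact: measurable_ulop.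
- by apply/measurable_EFinP; exact: measurable_st BC.
- by apply: filterS2 vF Hw => x vF Hw _; rewrite (stM (imap_bnd FC) HC) -vF Hw.
Qed.

Lemma ulop_contraction v (c : R) : Linf P v -> {ae P, forall x, `|v x| <= c} ->
  (\int[P]_x (`|ulop v x|)%:E <= c%:E)%E.
Proof.
move=> vL vc; have c0 := ae_norm_le_ge0 vc.
have [F Fl] := Linf_lift vL; have vF := ulopE Fl; move: Fl => [[C FC] Fv].
have nFC := ibnd_norm FC; have nMC := ibnd_norm (imap_bnd FC).
have mv : measurable_fun setT (fun x => (`|v x|)%:E).
  by apply/measurable_EFinP; apply: measurableT_comp => //; case: vL.
have -> : (\int[P]_x (`|ulop v x|)%:E = \int[P]_x (st (fun i x => `|imap F i x|) x)%:E)%E.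
  apply: ae_eq_integral => //.
  - apply/measurable_EFinP; apply: measurableT_comp => //; exact: measurable_ulop.
  - by apply/measurable_EFinP; exact: measurable_st nMC.
  - by apply: filterS vF => x vF _; rewrite (st_norm (imap_bnd FC)) vF.
rewrite (integral_st nMC).
apply: (@le_trans _ _ (\int[P]_x (`|v x|)%:E)%E); last first.
  rewrite -[leRHS](@integral_lcst _ W).
  apply: ae_ge0_le_integral => //; apply: filterS vc => x vc _.
  by rewrite lee_fin.
have -> : (\int[P]_x (`|v x|)%:E = \int[P]_x (st (fun i x => `|F i x|) x)%:E)%E.
  apply: ae_eq_integral => //.
  - by apply/measurable_EFinP; exact: measurable_st nFC.
  - by apply: filterS Fv => x Fv _; rewrite (st_norm FC) Fv.
rewrite (integral_st nFC) lee_fin.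
apply: (ultra_le (ifexp_cvg _ _ nMC) (ifexp_cvg _ _ nFC)).
by apply: filterE => i; exact: M_contr.
Qed.

Lemma ulop_markov : markov_graphop P ulop.
Proof.
split; [split; [|split; [|split]]|split; [|split]].
- by move=> v _; exact: integrable_ulop.
- move=> v w vL wL vw; have [F Fv] := Linf_lift vL; have [H Hw] := Linf_lift wL.
  have Fw : slift w F by split; [exact: Fv.1|apply: filterS2 Fv.2 vw => x -> ->].
  by apply: filterS2 (ulopE Fv) (ulopE Fw) => x -> ->.
- move=> a b v w vL wL; have [F Fv] := Linf_lift vL; have [H Hw] := Linf_lift wL.
  have vF := ulopE Fv; have wH := ulopE Hw.
  move: Fv Hw => [[C FC] Fv] [[C' HC] Hw].
  have BC := ibndD (ibndZ a FC) (ibndZ b HC).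
  have /ulopE S : slift (fun y => a * v y + b * w y) (fun i x => a * F i x + b * H i x).
    split; first by exists (`|a| * C + `|b| * C').
    apply: filterS2 Fv Hw => x Fv Hw.
    by rewrite (stD (ibndZ a FC) (ibndZ b HC)) (stZ _ FC) (stZ _ HC) Fv Hw.
  apply: filterS3 S vF wH => x -> -> ->.
  rewrite [imap _](_ : _ = fun i x => a * imap F i x + b * imap H i x).
    by rewrite (stD (ibndZ a (imap_bnd FC)) (ibndZ b (imap_bnd HC)))
      (stZ _ (imap_bnd FC)) (stZ _ (imap_bnd HC)).
  by apply: functional_extensionality_dep => i; apply/funext => y; exact: M_lin.
- by exists 1 => v c vL vc; rewrite mul1r; exact: ulop_contraction.
- move=> v w vL wL; have [F Fv] := Linf_lift vL; have [H Hw] := Linf_lift wL.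
  rewrite (integral_ulopM vL wL Fv Hw) (integral_ulopM wL vL Hw Fv).
  by congr (ulim _)%:E; apply/funext => i; exact: M_sym.
- move=> v vL v0; have [F [[C FC] Fv]] := Linf_lift vL.
  have nFC := ibnd_norm FC.
  (* A lift of a nonnegative function may take negative values; its absolute value is another lift,
     to which [M_ge0] applies. *)
  have /ulopE S : slift v (fun i x => `|F i x|).
    split; first by exists C.
    by apply: filterS2 v0 Fv => x v0 Fv; rewrite (st_norm FC) Fv ger0_norm.
  apply: filterS S => x ->; rewrite -(@st_cst _ W 0 x).
  by apply: le_st (ibnd_cst _) (imap_bnd nFC) _ x => i y; exact: M_ge0.
- have S := ulopE (lift_cst 1).
  have B1 := imap_bnd (@ibnd_cst _ W 1).
  have BC := ibndD B1 (@ibnd_cst _ W (-1)).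
  have /lprob_aeP N : lnull [set x | st (fun i y => imap (fun _ _ => 1) i y + -1) x <> 0].
    apply: fexp_st_null BC _; rewrite (_ : (fun i => _) = fun=> 0); first exact: cvg_cst.
    by apply/funext => i; exact: M_one.
  apply: filterS2 S N => x ->; rewrite (stD B1 (ibnd_cst _)) st_cst.
  by move/subr0_eq.
Qed.

End UltraOperator.

(** * Laws and profiles *)

(** It suffices to treat open sets, and each is the union of the boxes it contains that have
    rational centres and dyadic radii. There are countably many, and their preimages are measurable
    coordinate by coordinate. *)
Lemma measurable_borel_preimage (R : realType) d (T : measurableType d) (m : nat)
    (X : T -> 'I_m -> R) (B : set ('I_m -> R)) :
  (forall a, measurable_fun setT (fun x => X x a)) -> borel_Rm B ->
  measurable (X @^-1` B).
Proof.
move=> mX bB; rewrite -[X in measurable X]setTI; move: B bB.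
apply: (@smallest_sub _ _ _ (image_set_system setT X (@measurable _ T))).
  apply: sigma_algebra_image; exact: sigma_algebra_measurable.
move=> U oU; rewrite /image_set_system/= setTI.
pose box (p : {ffun 'I_m -> rat} * nat) : set ('I_m -> R) :=
  [set y | forall a, `|y a - ratr (p.1 a)| < weight R p.2].
pose F p := if pselect (box p `<=` U) then X @^-1` (box p) else set0.
have -> : X @^-1` U = \bigcup_p F p.
  apply/seteqP; split=> [x Ux|x [p _]]; last first.
    by rewrite /F; case: pselect => // sub; exact: sub.
  have [r r0 rU] := oU _ Ux.
  (* The half pays for two steps: from [X x] to the rational centre, and from there to [y]. *)
  have [n nr] := @weight_lt R (r / m.+1%:R / 2) (divr_gt0 (divr_gt0 r0 (ltr0Sn _ _)) (ltr0Sn _ _)).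
  have /choice[q qP] a : exists q : rat, `|X x a - ratr q| < weight R n.
    have w0 := weight_gt0 R n.
    have /rat_in_itvoo[q] : X x a - weight R n < X x a + weight R n by lra.
    by rewrite in_itv/= => qX; exists q; rewrite ltr_norml; lra.
  exists ([ffun a => q a], n) => //; rewrite /F; case: pselect => [_ a|[]] /=.
    by rewrite ffunE.
  move=> y /= yq; apply: rU; apply: euclid_dist_lt => // a.
  have := yq a; rewrite ffunE /=; have := qP a; have := ler_distD (ratr (q a)) (X x a) (y a).
  rewrite [`|ratr _ - y a|]distrC; set s := r / _ in nr *; lra.
apply: countable_bigcupT_measurable => [|p]; first exact: countableP.
rewrite /F; case: pselect => bU /=; last exact: measurable0.
rewrite (_ : _ @^-1` _ = \bigcap_(a in setT) [set x | `|X x a - ratr (p.1 a)| < weight R p.2]).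
  apply: fin_bigcap_measurable => // a _; rewrite -[X in measurable X]setTI.
  have mf : measurable_fun setT (fun x => `|X x a - ratr (p.1 a)|).
    by apply: measurableT_comp => //; exact: measurable_funB.
  have := mf measurableT _ (measurable_itv `]-oo, weight R p.2[).
  by congr measurable; congr (_ `&` _); apply/seteqP; split=> x; rewrite /= in_itv.
by apply/seteqP; split=> x /= h a; [move=> _; exact: h|exact: h].
Qed.

Lemma op_law_monotone (R : realType) d (T : measurableType d) (P : probability T R) m
    (X : T -> 'I_m -> R) : (forall a, measurable_fun setT (fun x => X x a)) ->
  monotone_law (op_law P X).
Proof.
move=> mX; have mB B := measurable_borel_preimage (B := B) mX; split.
  move=> B /mB bB; rewrite /op_law fine_ge0//= -lee_fin fineK ?probability_le1//.
  exact: fin_num_measure.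
move=> B B' /mB bB /mB bB' BB'; rewrite /op_law fine_le ?fin_num_measure//.
by apply: le_measure; rewrite ?inE// => x; exact: BB'.
Qed.

(** * Dyadic cells and approximation of laws *)

Section Cells.
Variables (R : realType) (m N : nat).

Definition cell := {ffun 'I_m -> {ffun 'I_N -> bool}}.

Definition cell_of (y : 'I_m -> R) : cell :=
  [ffun a => [ffun k : 'I_N => digit ((y a + 1) / 2) k]].

(** The lower corner of the cell, whose side is [2 * weight R N]; it undoes the map from [-1, 1] to
    [0, 1] used in [cell_of]. *)
Definition center (c : cell) (a : 'I_m) : R :=
  2 * (\sum_(k < N) weight R k.+1 * (c a k)%:R) - 1.

Lemma cell_of_close y : (forall a, `|y a| <= 1) ->
  forall a, `|y a - center (cell_of y) a| <= 2 * weight R N.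
Proof.
move=> y1 a; have := y1 a; rewrite ler_norml => y1a.
have /(drem_bound N) : 0 <= (y a + 1) / 2 <= 1 by lra.
have -> : center (cell_of y) a =
    2 * (\sum_(k < N) weight R k.+1 * (digit ((y a + 1) / 2) k)%:R) - 1.
  by congr (2 * _ - 1); apply: eq_bigr => k _; rewrite !ffunE.
by have := digit_sum ((y a + 1) / 2) N; rewrite ler_norml; lra.
Qed.

End Cells.

Section FiniteLaw.
Variables (R : realType) (W : fprob R) (m : nat).
Implicit Type X : W -> 'I_m -> R.

Definition flaw X : law R m := fun B => \sum_x fmass x * \1_B (X x).

Lemma flawE X B : flaw X B = fexp (fun x => \1_B (X x)).
Proof. by []. Qed.

Lemma flaw_monotone X : monotone_law (flaw X).
Proof.
split=> [B _|B B' _ _ BB'].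
  rewrite flawE; apply/andP; split.
    by apply: sumr_ge0 => x _; rewrite mulr_ge0 ?fmass_ge0.
  by rewrite -(fexp_cst W 1); apply: le_fexp => x; rewrite indicE; case: (_ \in _).
apply: le_fexp => x; rewrite !indicE ler_nat.
have [/set_mem/BB'/mem_set->|] := boolP (X x \in B); last by [].
by [].
Qed.

Lemma flaw_cell_mass N X : (forall x a, `|X x a| <= 1) ->
  cell_mass (@center R m N) (2 * weight R N) (flaw X)
    (fun J => fpr (fun x => cell_of N (X x) \in J)).
Proof.
move=> X1; split=> B J _ h; apply: le_fexp => x; rewrite indicE ler_nat.
  have [/set_mem BX|] := boolP (X x \in B); last by [].
  by rewrite (h (cell_of N (X x)) (X x) BX) //; exact: cell_of_close.
have [cJ|] := boolP (cell_of N (X x) \in J); last by [].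
by rewrite mem_set//; apply: h cJ _; exact: cell_of_close.
Qed.

End FiniteLaw.

Section LoebLaw.
Variables (R : realType) (W : nat -> fprob R) (m : nat).
Local Notation P := (@lprob R W).

Lemma le_imass_ae (S T : isets W) : lnull (iset S `\` iset T) -> imass S <= imass T.
Proof.
move=> ST; rewrite -(@lmassE _ _ (iset T `|` (iset S `\` iset T)) T).
  rewrite (lmassE (_ : lrep _ (fun i x => S i x || T i x))).
    by apply: le_imass; rewrite isetU => x; left.
  apply: sub_lnull (@lnull0 _ W) => x /=; apply; rewrite isetU.
  split=> [[Tx|[Sx _]]|[Sx|Tx]]; [by right|by left| |by left].
  by have [Tx|Tx] := pselect (iset T x); [left|right].
apply: sub_lnull ST => x /= nTx; apply: contrapT => nST; apply: nTx.
by split=> [[]//|]; left.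
Qed.

Lemma lmass_le (B : set (loeb W)) (S : isets W) : lmeas B -> lnull (B `\` iset S) ->
  lmass B <= imass S.
Proof.
move=> [T BT] BS; rewrite (lmassE BT); apply: le_imass_ae.
apply: sub_lnull (lnullU BT BS) => x [Tx nSx].
by have [Bx|nBx] := pselect (B x); [right|left => /= -[_ /(_ Tx)]].
Qed.

Lemma lmass_ge (B : set (loeb W)) (S : isets W) : lmeas B -> lnull (iset S `\` B) ->
  imass S <= lmass B.
Proof.
move=> [T BT] BS; rewrite (lmassE BT); apply: le_imass_ae.
apply: sub_lnull (lnullU BT BS) => x [Sx nTx].
by have [Bx|nBx] := pselect (B x); [left => /= -[/(_ Bx)]|right].
Qed.

Variables (F : 'I_m -> ifun W) (X : loeb W -> 'I_m -> R).
Arguments F : clear implicits.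
Hypothesis F1 : forall a, ibnd 1 (F a).
Hypothesis mX : forall a, measurable_fun setT (fun x => X x a).
Hypothesis XF : forall a, {ae P, forall x, X x a = st (F a) x}.

Definition cell_set N (J : {set cell m N}) : isets W :=
  fun i y => cell_of N (fun a => F a i y) \in J.
Arguments cell_set {N} J i y.

(** The limit of points of one cell may lie on its boundary and belong to another cell, so equality
    of cells is lost. Closeness to the corner of [c] survives, and [cell_mass] asks for nothing
    more. *)
Lemma st_cell N (x : loeb W) : exists c : cell m N,
  (\forall i \near fultra, cell_of N (fun a => F a i (x i)) = c) /\
  forall a, `|st (F a) x - center R c a| <= 2 * weight R N.
Proof.
have [c hc] := fultra_pigeonhole (fun i => cell_of N (fun a => F a i (x i))).
exists c; split=> // a.
have h : (fun i => `|F a i (x i) - center R c a|) @ fultra --> `|st (F a) x - center R c a|.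
  by apply: cvg_norm; apply: cvgB; [exact: stP (F1 a) x|exact: cvg_cst].
apply: (ultra_le h (cvg_cst _)); apply: filterS hc => i <-.
by apply: (@cell_of_close R m N (fun a => F a i (x i))) => b; exact: F1.
Qed.

Lemma loeb_cell_mass N : cell_mass (@center R m N) (2 * weight R N) (op_law P X)
  (fun J => imass (cell_set J)).
Proof.
have null : lnull [set x | ~ forall a, X x a = st (F a) x].
  by apply/lprob_aeP; apply: filter_forall => a; exact: XF.
split=> B J bB h.
  apply: lmass_le; first exact: measurable_borel_preimage mX bB.
  apply: sub_lnull null => x [Bx nJ]; apply: contrapT => /contrapT XEx; apply: nJ.
  have [c [xc cX]] := st_cell N x.
  apply: filterS xc => i ci; rewrite /cell_set ci; apply: h Bx _ => a.
  by rewrite XEx.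
apply: lmass_ge; first exact: measurable_borel_preimage mX bB.
apply: sub_lnull null => x [Jx nB]; apply: contrapT => /contrapT XEx; apply: nB.
have [c [xc cX]] := st_cell N x.
have [i [iJ ic]] := fultra_ex2 Jx xc.
rewrite /cell_set ic in iJ; apply: h iJ _ => a.
by rewrite XEx.
Qed.

Lemma law_near (e : R) : 0 < e -> \forall i \near fultra,
  LP_dist (flaw (fun (y : W i) a => F a i y)) (op_law P X) <= e.
Proof.
(* Both laws stay within [2 * weight R N] of the same corners, whence the 4. There are finitely many
   sets of cells, so their masses converge simultaneously. *)
move=> e0; have [N Ne] : exists N, weight R N < e / m.+1%:R / 4.
  by apply: weight_lt; rewrite !divr_gt0.
have : \forall i \near fultra, forall J : {set cell m N},
    `|fpr (cell_set J i) - imass (cell_set J)| < e.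
  by apply: filter_forall => J; exact: ultra_near_dist (imass_cvg _) e0.
apply: filterS => i hi.
apply: (cell_mass_LP (flaw_cell_mass N _) (loeb_cell_mass N)) => //.
- by move=> x a; exact: F1.
- by set s := e / _ in Ne *; lra.
- by move=> J; apply/ltW/hi.
Qed.

End LoebLaw.

(** * Convergence of profiles along the ultrafilter *)

Section Profiles.
Variable R : realType.

Definition fprofile (W : fprob R) (M : (W -> R) -> W -> R) (k : nat) : set (law R (k + k)) :=
  [set flaw (stack v (fun a => M (v a))) | v in
    [set v : 'I_k -> W -> R | forall a x, -1 <= v a x <= 1]].
Arguments fprofile {W} M k.

Lemma fprofile_law_set (W : fprob R) (M : (W -> R) -> W -> R) k :
  law_set (fprofile M k).
Proof.
split; last by move=> _ [v _ <-]; exact: flaw_monotone.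
by eexists; exists (fun _ _ => 0) => //= _ _; rewrite lerN10 ler01.
Qed.

Lemma measurable_stack d (T : measurableType d) k (v w : 'I_k -> T -> R) :
  (forall a, measurable_fun setT (v a)) -> (forall a, measurable_fun setT (w a)) ->
  forall j, measurable_fun setT (fun x => stack v w x j).
Proof. by move=> mv mw j; rewrite /stack; case: (fintype.split j). Qed.

Lemma op_profile_law_set d (T : measurableType d) (P : probability T R) A k :
  P_operator P A -> law_set (op_profile P A k).
Proof.
move=> [Aint _]; split; first by eexists; exists (fun _ _ => 0) => //= _; split=> // _; rewrite lerN10 ler01.
move=> _ [v vP <-]; apply: op_law_monotone; apply: measurable_stack => a.
  exact: (vP a).1.
have /Aint/integrableP[/measurable_EFinP] // : Linf P (v a).
by split; [exact: (vP a).1|exists 1; apply: aeW => x; rewrite ler_norml; exact: (vP a).2].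
Qed.

Variables (W : nat -> fprob R) (M : forall i, (W i -> R) -> W i -> R).
Variable A : (loeb W -> R) -> loeb W -> R.
Arguments M : clear implicits.
Local Notation P := (@lprob R W).
Hypothesis M_bnd : forall i (C : R) (F : W i -> R), (forall x, `|F x| <= C) ->
  forall x, `|M i F x| <= C.
Hypothesis mA : forall v, measurable_fun setT (A v).
Hypothesis A_lift : forall v F, slift v F ->
  {ae P, forall x, A v x = st (fun i => M i (F i)) x}.

(** This concerns one fixed family [v]; the set of good indices depends on it. Uniformity over the
    profile is the business of the next two lemmas. *)
Lemma profile_law_near k (v : 'I_k -> loeb W -> R) (F : 'I_k -> ifun W) (e : R) :
  0 < e -> (forall a, measurable_fun setT (v a)) -> (forall a, ibnd 1 (F a)) ->
  (forall a, {ae P, forall x, st (F a) x = v a x}) ->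
  \forall i \near fultra, LP_dist
    (flaw (stack (fun a => F a i) (fun a => M i (F a i))))
    (op_law P (stack v (fun a => A (v a)))) <= e.
Proof.
move=> e0 mv F1 Fv.
pose FF j : ifun W := match fintype.split j with
  | inl a => F a | inr a => fun i => M i (F a i) end.
have FF1 j : ibnd 1 (FF j).
  by rewrite /FF; case: (fintype.split j) => a //= i; apply: M_bnd; exact: F1.
have := @law_near R W (k + k) FF (stack v (fun a => A (v a))) FF1.
have XF j : {ae P, forall x, stack v (fun a => A (v a)) x j = st (FF j) x}.
  rewrite /FF /stack; case: (fintype.split j) => a /=.
    by apply: filterS (Fv a) => x ->.
  by apply: A_lift; split; [exists 1|].
move=> /(_ (measurable_stack mv (fun a => mA (v a))) XF _ e0).
apply: filterS => i; congr (LP_dist (flaw _) _ <= _).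
apply/funext => x; apply/funext => j.
by rewrite /FF /stack; case: (fintype.split j).
Qed.

(** A bad family is chosen for every index that has one. Together the choices form one bounded
    internal family, whose standard part belongs to the profile of [A] and is close to almost all of
    them. *)
Lemma fprofile_near_op_profile k (e : R) : 0 < e -> \forall i \near fultra,
  forall x, fprofile (M i) k x -> exists2 y, op_profile P A k y & LP_dist x y <= e.
Proof.
move=> e0; apply: contrapT => /fultra_not far.
pose bad i (v : 'I_k -> W i -> R) := (forall a x, -1 <= v a x <= 1) /\
  forall y, op_profile P A k y -> ~ (LP_dist (flaw (stack v (fun a => M i (v a)))) y <= e).
have : forall i, exists v : 'I_k -> W i -> R, (forall a x, -1 <= v a x <= 1) /\
    ((exists v', @bad i v') -> bad i v).
  move=> i; have [[v bv]|nb] := pselect (exists v', @bad i v'); first by exists v; split => //; exact: bv.1.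
  by exists (fun _ _ => 0); split => // _ _; rewrite lerN10 ler01.
move=> /(_ _)/cid-/all_sig[F FP].
pose G a : ifun W := fun i => F i a.
have G1 a : ibnd 1 (G a) by move=> i x; rewrite ler_norml; exact: (FP i).1.
have near_e := profile_law_near e0 (fun a => measurable_st (G1 a)) G1
  (fun a => aeW P (fun x => erefl (st (G a) x))).
have [i [ci le]] := fultra_ex2 far near_e.
have /((FP i).2)[_] : exists v', @bad i v'.
  move/existsNP : ci => [x /not_implyP[[v vP <-] h]].
  by exists v; split=> // y yP ye; apply: h; exists y.
apply; last exact: le.
exists (fun a => st (G a)) => // a; split; first exact: measurable_st (G1 a).
by move=> x; rewrite -ler_norml; exact: st_bound (G1 a) x.
Qed.

(* Every law of the profile is coded, up to [e / 3], by finitely many digits of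
   its cell masses; so some code is shared by the offending laws for
   [fultra]-almost all [i], and a lift of a single one of them approximates
   them all. *)
Lemma op_profile_near_fprofile k (e : R) : 0 < e -> \forall i \near fultra,
  forall y, op_profile P A k y -> exists2 x, fprofile (M i) k x & LP_dist x y <= e.
Proof.
move=> e0; apply: contrapT => /fultra_not far.
pose good (v : 'I_k -> loeb W -> R) := forall a, measurable_fun setT (v a) /\
  forall x, -1 <= v a x <= 1.
pose olaw (v : 'I_k -> loeb W -> R) := op_law P (stack v (fun a => A (v a))).
have olaw_mono v : good v -> monotone_law (olaw v).
  by move=> gv; apply: op_law_monotone; apply: measurable_stack => a //; exact: (gv a).1.
have : forall i, exists v, good v /\ ((exists2 y, op_profile P A k y &
    forall x, fprofile (M i) k x -> ~ (LP_dist x y <= e)) ->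
    forall x, fprofile (M i) k x -> ~ (LP_dist x (olaw v) <= e)).
  move=> i; have [[y [v gv <-] h]|nb] := pselect (exists2 y, op_profile P A k y &
    forall x, fprofile (M i) k x -> ~ (LP_dist x y <= e)); first by exists v.
  by exists (fun _ _ => 0); split => // a; split=> // _; rewrite lerN10 ler01.
move=> /choice[v vP].
have gv i := (vP i).1.
have : forall i, exists F : 'I_k -> ifun W, (forall a, ibnd 1 (F a)) /\
    forall a, {ae P, forall x, st (F a) x = v i a x}.
  move=> i; suff /choice[F FP] : forall a, exists F : ifun W, ibnd 1 F /\
      {ae P, forall x, st F x = v i a x}.
    by exists F; split=> a; case: (FP a).
  move=> a; have [|F F1 Fv] := @lift_bound R W (v i a) 1 (gv i a).1 ltr01.
    by apply: aeW => x; rewrite ler_norml; exact: (gv i a).2.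
  by exists F.
move=> /choice[F FP].
pose FF i j : ifun W := match fintype.split j with
  | inl a => F i a | inr a => fun n => M n (F i a n) end.
have FF1 i j : ibnd 1 (FF i j).
  rewrite /FF; case: (fintype.split j) => a //=; first exact: (FP i).1.
  by move=> n; apply: M_bnd; exact: (FP i).1.
have XF i j : {ae P, forall x, stack (v i) (fun a => A (v i a)) x j = st (FF i j) x}.
  rewrite /FF /stack; case: (fintype.split j) => a /=.
    by apply: filterS ((FP i).2 a) => x ->.
  by apply: A_lift; split; [exists 1; exact: (FP i).1|exact: (FP i).2].
have mX i := measurable_stack (fun a => (gv i a).1) (fun a => mA (v i a)).
have e3 : 0 < e / 3 by rewrite divr_gt0.
have [N Ne] : exists N, weight R N < e / 3 / (k + k).+1%:R / 4.
  by apply: weight_lt; rewrite !divr_gt0.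
have [n ne] := weight_lt e3.
pose mass i (J : {set cell (k + k) N}) := imass (cell_set (FF i) J).
have mass01 i J : 0 <= mass i J <= 1.
  rewrite imass_ge0/= -(@imassT _ W); apply: le_imass => x _; exact: filterE.
have [c hc] := fultra_pigeonhole (fun i =>
  [ffun J : {set cell (k + k) N} => [ffun l : 'I_n => digit (mass i J) l]]).
have close i j : [ffun J : {set cell (k + k) N} => [ffun l : 'I_n => digit (mass i J) l]] = c ->
    [ffun J : {set cell (k + k) N} => [ffun l : 'I_n => digit (mass j J) l]] = c ->
    LP_dist (olaw (v i)) (olaw (v j)) <= e / 3.
  move=> ic jc; apply: (cell_mass_LP (loeb_cell_mass (FF1 i) (mX i) (XF i) N)
    (loeb_cell_mass (FF1 j) (mX j) (XF j) N)) => //.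
    by set s := e / 3 / _ in Ne *; lra.
  move=> J; apply: le_trans (ltW ne); rewrite -/(mass i J) -/(mass j J).
  have Eij : \sum_(l < n) weight R l.+1 * (digit (mass i J) l)%:R =
      \sum_(l < n) weight R l.+1 * (digit (mass j J) l)%:R.
    apply: eq_bigr => l _; congr (_ * (nat_of_bool _)%:R).
    have /ffunP/(_ J) : [ffun J : {set cell (k + k) N} => [ffun l : 'I_n => digit (mass i J) l]] =
      [ffun J : {set cell (k + k) N} => [ffun l : 'I_n => digit (mass j J) l]].
      by rewrite ic jc.
    by rewrite !ffunE => /ffunP/(_ l); rewrite !ffunE.
  have := digit_sum (mass i J) n; have := digit_sum (mass j J) n; rewrite Eij.
  have := drem_bound n (mass01 i J); have := drem_bound n (mass01 j J).
  by rewrite ler_norml; lra.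
have [i0 [far0 c0]] := fultra_ex2 far hc.
have near0 := profile_law_near e3 (fun a => (gv i0 a).1) (FP i0).1 (FP i0).2.
have [j [[farj cj] lej]] := fultra_ex2 (filterI far hc) near0.
have xP : fprofile (M j) k (flaw (stack (fun a => F i0 a j) (fun a => M j (F i0 a j)))).
  exists (fun a => F i0 a j) => // a x; rewrite -ler_norml; exact: (FP i0).1.
have badj : exists2 y, op_profile P A k y &
    forall x, fprofile (M j) k x -> ~ (LP_dist x y <= e).
  move/existsNP : farj => [y /not_implyP[yP h]]; exists y => // x xP' xy.
  by apply: h; exists x.
apply: ((vP j).2 badj _ xP).
(* [LP_triangle] takes strict bounds, so both thirds are enlarged to halves. *)
have e32 : e / 3 < e / 2 by lra.
have := LP_triangle (flaw_monotone _) (olaw_mono _ (gv i0)) (olaw_mono _ (gv j))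
  (le_lt_trans lej e32) (le_lt_trans (close i0 j c0 cj) e32).
by rewrite -splitr.
Qed.

Lemma hausdorff_profile_near k (e : R) : 0 < e -> P_operator P A ->
  \forall i \near fultra, hausdorff (fprofile (M i) k) (op_profile P A k) <= e.
Proof.
move=> e0 PA; apply: filterS2 (fprofile_near_op_profile k e0)
  (op_profile_near_fprofile k e0) => i h1 h2.
by apply: hausdorff_le => //; [exact: (fprofile_law_set _ _).1|exact: (op_profile_law_set _ PA).1].
Qed.

End Profiles.

(** * Random walks on graphs *)

Section GraphWalk.
Variable R : realType.
Implicit Type G : simple_graph.

Lemma degE G (i : 'I_(gn G)) : deg i = #|[pred j | gadj G i j]|.
Proof. by apply: eq_card => j; rewrite unfold_in inE; apply/asboolP/idP. Qed.

Lemma nedgesE G : nedges G =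
  #|[pred p : 'I_(gn G) * 'I_(gn G) | gadj G p.1 p.2 && (p.1 < p.2)%N]|.
Proof. by apply: eq_card => p; rewrite unfold_in inE; apply/asboolP/idP. Qed.

(** Ordered adjacent pairs split into increasing and decreasing ones, exchanged by the swap;
    irreflexivity leaves no diagonal. *)
Lemma handshake G : (\sum_(i : 'I_(gn G)) deg i = 2 * nedges G)%N.
Proof.
pose D := [set p : 'I_(gn G) * 'I_(gn G) | gadj G p.1 p.2]%SET.
pose L := [set p : 'I_(gn G) * 'I_(gn G) | gadj G p.1 p.2 && (p.1 < p.2)%N]%SET.
pose U := [set p : 'I_(gn G) * 'I_(gn G) | gadj G p.1 p.2 && (p.2 < p.1)%N]%SET.
have -> : (\sum_(i : 'I_(gn G)) deg i = #|D|)%N.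
  rewrite -sum1_card (eq_bigl (fun p : 'I_(gn G) * 'I_(gn G) => true && gadj G p.1 p.2)).
    rewrite -(pair_big_dep xpredT (fun i j => gadj G i j) (fun _ _ => 1%N)) /=.
    by apply: eq_bigr => i _; rewrite degE -sum1_card; apply: eq_bigl => j; rewrite inE.
  by move=> p; rewrite inE.
have -> : D = (L :|: U)%SET.
  apply/setP => -[i j]; rewrite !inE /= -andb_orr.
  have [ij|//] := boolP (gadj G i j); rewrite /= -neq_ltn.
  by apply/esym/eqP => /val_inj ij'; rewrite ij' gadj_irr in ij.
have En : nedges G = #|L| by rewrite nedgesE; apply: eq_card => p; rewrite !inE.
rewrite cardsU (_ : (L :&: U)%SET = finset.set0) ?cards0 ?subn0.
  rewrite En mul2n -addnn; congr (_ + _)%N.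
  have swapK : cancel (fun p : 'I_(gn G) * 'I_(gn G) => (p.2, p.1)) (fun p => (p.2, p.1)) by case.
  rewrite -(card_imset L (can_inj swapK)).
  apply: eq_card => -[i j]; rewrite inE /=; apply/idP/imsetP => [/andP[ij lt]|[[a b]]].
    by exists (j, i); rewrite ?inE //= gadj_sym ij.
  by rewrite inE /= => /andP[ab lt] [-> ->]; rewrite gadj_sym ab.
apply/setP => -[i j]; rewrite !inE /=; case: (gadj G i j) => //=.
by case: ltngtP.
Qed.

Lemma nu_ge0 G (i : 'I_(gn G)) : 0 <= nu R i.
Proof. by rewrite /nu divr_ge0. Qed.

Lemma nu_sum1 G : has_edge G -> \sum_(i : 'I_(gn G)) nu R i = 1.
Proof.
move=> e; rewrite /nu -mulr_suml -natr_sum handshake divff// pnatr_eq0.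
by rewrite muln_eq0 negb_or /= -lt0n.
Qed.

Definition walk_prob G (e : has_edge G) : fprob R := FProb (@nu_ge0 G) (nu_sum1 e).

Variables (G : simple_graph) (e : has_edge G).
Local Notation W := (walk_prob e).
Implicit Types F H : 'I_(gn G) -> R.

Lemma deg_sum (i : 'I_(gn G)) : \sum_(j | gadj G i j) 1 = (deg i)%:R :> R.
Proof.
by rewrite sumr_const degE.
Qed.

Lemma deg0_adj (i : 'I_(gn G)) : deg i = 0%N -> forall j, gadj G i j = false.
Proof.
by rewrite degE => /card0_eq h j; have := h j; rewrite inE.
Qed.

(** The degree cancels, leaving the same weight on every ordered edge: the walk is reversible. At an
    isolated vertex both sides vanish. *)
Lemma nu_MG F (i : 'I_(gn G)) :
  nu R i * MG F i = (2 * nedges G)%:R^-1 * \sum_(j | gadj G i j) F j.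
Proof.
rewrite /nu /MG; have [d0|d0] := eqVneq (deg i) 0%N.
  by rewrite big_pred0 ?mulr0//; exact: deg0_adj.
by rewrite -mulrA mulrCA !mulrA mulfK// pnatr_eq0.
Qed.

Lemma MG_lin a b F H i : MG (fun y => a * F y + b * H y) i = a * MG F i + b * MG H i.
Proof.
rewrite /MG big_split/= -!mulr_sumr; ring.
Qed.

Lemma MG_bnd (C : R) F : (forall x, `|F x| <= C) -> forall x, `|MG F x| <= C.
Proof.
move=> FC i; have C0 : 0 <= C by apply: le_trans (FC i).
rewrite /MG normrM ger0_norm ?invr_ge0//.
have [d0|d0] := eqVneq (deg i) 0%N; first by rewrite d0 invr0 mul0r.
have dp : 0 < (deg i)%:R :> R by rewrite ltr0n lt0n.
rewrite mulrC ler_pdivrMr// mulrC -deg_sum mulr_suml.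
apply: le_trans (ler_norm_sum _ _ _) _; apply: ler_sum => j _.
by rewrite mul1r.
Qed.

Lemma MG_ge0 F : (forall x, 0 <= F x) -> forall x, 0 <= MG F x.
Proof. by move=> F0 i; rewrite mulr_ge0 ?invr_ge0// sumr_ge0. Qed.

Lemma MG_sym F H : fexp (W := W) (fun x => MG F x * H x) =
  fexp (W := W) (fun x => MG H x * F x).
Proof.
have E K L : fexp (W := W) (fun x => MG K x * L x) =
    (2 * nedges G)%:R^-1 * \sum_(i : 'I_(gn G)) \sum_(j | gadj G i j) K j * L i.
  rewrite /fexp /= mulr_sumr; apply: eq_bigr => i _.
  by rewrite mulrA nu_MG -mulrA -mulr_suml.
rewrite !E; congr (_ * _); rewrite (exchange_big_dep xpredT)//=.
apply: eq_bigr => i _; apply: eq_big => [j|j _]; [exact: gadj_sym|exact: mulrC].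
Qed.

Lemma nu_MG1 (i : 'I_(gn G)) : nu R i * MG (fun=> 1) i = nu R i.
Proof. by rewrite nu_MG deg_sum mulrC. Qed.

Lemma MG_one : fexp (W := W) (fun x => `|MG (fun=> 1) x - 1|) = 0.
Proof.
apply: big1 => i _ /=; rewrite -{1}(ger0_norm (nu_ge0 i)) -normrM mulrBr nu_MG1.
by rewrite mulr1 subrr normr0.
Qed.

(** Pointwise [|MG F|] is at most [MG |F|], and by symmetry the mean of the latter is that of [|F|]
    times [MG 1], which is 1 off a set of mass 0. *)
Lemma MG_contr F : fexp (W := W) (fun x => `|MG F x|) <= fexp (W := W) (fun x => `|F x|).
Proof.
have -> : fexp (W := W) (fun x => `|F x|) = fexp (W := W) (fun x => MG (fun y => `|F y|) x * 1).
  by rewrite MG_sym; apply: eq_bigr => i _ /=; rewrite mulrA nu_MG1.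
apply: le_fexp => i; rewrite mulr1 /MG normrM ger0_norm ?invr_ge0//.
by rewrite ler_wpM2l ?invr_ge0// ler_norm_sum.
Qed.

End GraphWalk.

Lemma ultralimit_graphop (R : realType) (G : nat -> simple_graph) :
  (forall i, has_edge (G i)) ->
  exists (d : measure_display) (T : measurableType d) (P : probability T R)
         (A : (T -> R) -> (T -> R)),
    markov_graphop P A /\ forall (k : nat) (e : R), 0 < e ->
      \forall i \near fultra, hausdorff (graph_profile R (G i) k) (op_profile P A k) <= e.
Proof.
move=> hG; pose W i := walk_prob R (hG i).
pose M i : (W i -> R) -> W i -> R := @MG R (G i).
pose A := ulop (W := W) M.
have mkv : markov_graphop (@lprob R W) A.
  apply: ulop_markov => i *.
  - exact: MG_lin.
  - exact: MG_bnd.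
  - exact: MG_ge0.
  - exact: MG_sym.
  - exact: MG_one.
  - exact: MG_contr.
exists default_measure_display, (loeb W), (@lprob R W), A; split=> // k e e0.
apply: (@hausdorff_profile_near R W M A) => //.
- by move=> i; exact: MG_bnd.
- by move=> v; apply: measurable_ulop => i; exact: MG_bnd.
- move=> v F; apply: ulopE => i *.
  + exact: MG_lin.
  + exact: MG_bnd.
  + exact: MG_contr.
- by case: mkv.
Qed.

Lemma graph_profile_law_set (R : realType) G k : has_edge G -> law_set (graph_profile R G k).
Proof. by move=> e; exact: (@fprofile_law_set R (walk_prob R e) (@MG R G) k). Qed.

(** * From convergence of each profile to the two assertions *)

Lemma weighted_sum_cvg0 (R : realType) (h : nat -> nat -> R) :
  (forall i k, 0 <= h i k <= 1) ->
  (forall k, (0 < k)%N -> forall e : R, 0 < e -> \forall i \near \oo, h i k <= e) ->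
  (fun i => limn (fun N => \sum_(1 <= k < N) (2 : R) ^- k * h i k)) @ \oo --> (0 : R).
Proof.
move=> h01 h0; apply/cvgrPdist_le => e e0.
have e2 : 0 < e / 2 by rewrite divr_gt0.
have [K Ke] := weight_lt e2.
have : \forall i \near \oo, forall k : 'I_K.+1, (0 < k)%N -> h i k <= e / 2.
  apply: filter_forall => k; have [k0|] := ltnP 0 k.
    by apply: filterS (h0 _ k0 _ e2).
  by move=> _; apply: nearW.
apply: filterS => i hi; set u := fun N => _.
have u_nd : nondecreasing_seq u.
  apply/nondecreasing_seqP => -[|n]; first by rewrite /u !big_geq.
  rewrite /u [leRHS]big_nat_recr//= lerDl mulr_ge0 ?(ltW (weight_gt0 R _))//.
  by case/andP: (h01 i n.+1).
(* [u n.+1] has the terms from 1 to [n]. Those up to [K] are small by [hi]; each later one is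
   bounded by its weight, and these weights add up to [weight R K - weight R n]. *)
have ule n : u n.+1 <= e / 2 * (1 - weight R n) +
    (if (n <= K)%N then 0 else weight R K - weight R n).
  elim: n => [|n IH]; first by rewrite /u big_geq// weight0 subrr mulr0 addr0.
  rewrite /u big_nat_recr//= -/(u n.+1) -/(weight R n.+1).
  apply: le_trans (lerD IH (lexx _)) _; have := weightS R n; have w0 := weight_gt0 R n.+1.
  have /andP[hi0 hi1] := h01 i n.+1.
  case: (ltngtP n K) => nK.
  - have := hi (Ordinal (nK : (n.+1 < K.+1)%N)) isT => /= hK wS.
    have := ler_wpM2l (ltW w0) hK; nra.
  - by move=> wS; have := ler_wpM2l (ltW w0) hi1; nra.
  - by move=> wS; rewrite -nK; have := ler_wpM2l (ltW w0) hi1; nra.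
have ub n : u n <= e.
  apply: le_trans (u_nd n n.+1 (leqnSn n)) _; apply: le_trans (ule n) _.
  have w0 := weight_gt0 R n; have wK := weight_gt0 R K.
  by case: ifP => _; nra.
have u_cvg : cvgn u.
  by apply: nondecreasing_is_cvgn => //; exists e => _ [n _ <-].
rewrite sub0r normrN ger0_norm.
  by apply: limr_le => //; exact: nearW.
apply: limr_ge => //; apply: nearW => n; apply: sumr_ge0 => k _.
by rewrite mulr_ge0 ?(ltW (weight_gt0 R _))//; case/andP: (h01 i k).
Qed.

Theorem theorem5p4 (R : realType) :
  (forall G : nat -> simple_graph, (forall i, has_edge (G i)) ->
     exists phi : nat -> nat, (forall i, (phi i < phi i.+1)%N) /\
       rw_convergent R (fun i => G (phi i))) /\
  (forall G : nat -> simple_graph, (forall i, has_edge (G i)) -> rw_convergent R G ->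
     exists (d : measure_display) (T : measurableType d) (P : probability T R)
            (A : (T -> R) -> (T -> R)),
       markov_graphop P A /\
       (fun i => d_M (graph_profile R (G i)) (op_profile P A)) @ \oo --> 0).
Proof.
split=> [G hG|G hG cG]; have [d [T [P [A [mkv hA]]]]] := ultralimit_graphop R hG;
  have lG i k := graph_profile_law_set R k (hG i);
  have lA k := op_profile_law_set k mkv.1.
  have near_n n : \forall i \near fultra, forall k : 'I_n.+1,
      hausdorff (graph_profile R (G i) k) (op_profile P A k) <= weight R n.
    by apply: filter_forall => k; apply: hA; exact: weight_gt0.
  have /choice[f fP] (p : nat * nat) : exists i, (p.2 <= i)%N /\ forall k : 'I_p.1.+1,
      hausdorff (graph_profile R (G i) k) (op_profile P A k) <= weight R p.1.
    have ge : \forall i \near fultra, (p.2 <= i)%N by apply: fultra_oo; exact: nbhs_infty_ge.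
    exact: fultra_ex2 ge (near_n p.1).
  (* [f (n, q)] is an index at least [q] whose first profiles are within [weight R n] of those of
     [A]. Taking [q] beyond the previous value makes [phi] strictly increasing. *)
  pose phi := fix phi n := if n is n'.+1 then f (n, (phi n').+1) else f (0%N, 0%N).
  have phiP n (k : nat) : (k <= n)%N ->
      hausdorff (graph_profile R (G (phi n)) k) (op_profile P A k) <= weight R n.
    rewrite -ltnS => kn; have h p : p.1 = n ->
        hausdorff (graph_profile R (G (f p)) k) (op_profile P A k) <= weight R n.
      case: p => _ q /= ->; exact: ((fP (n, q)).2 (Ordinal kn)).
    by case: n kn h => [|n] kn h; exact: h.
  exists phi; split=> [i|k k0 e e0]; first exact: (fP (i.+1, (phi i).+1)).1.
  have e3 : 0 < e / 3 by rewrite divr_gt0.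
  have [N Ne] := weight_lt e3.
  have close i : (maxn k N <= i)%N ->
      hausdorff (graph_profile R (G (phi i)) k) (op_profile P A k) < e / 3.
    rewrite geq_max => /andP[ki Ni]; apply: le_lt_trans (phiP i k ki) _.
    apply: le_lt_trans Ne.
    by rewrite /weight lef_pV2 ?posrE ?exprn_gt0// ler_eXn2l ?ltr1n.
  exists (maxn k N) => i j /close hi /close hj.
  rewrite hausdorffC in hj.
  by apply: le_lt_trans (hausdorff_triangle (lG _ k) (lA k) (lG _ k) hi hj) _; lra.
exists d, T, P, A; split => //.
apply: weighted_sum_cvg0 => [i k|k k0 e e0].
  by rewrite hausdorff_ge0 ?hausdorff_le1.
have e3 : 0 < e / 3 by rewrite divr_gt0.
have [N hN] := cG k k0 _ e3.
have ge : \forall j \near fultra, (N <= j)%N by apply: fultra_oo; exact: nbhs_infty_ge.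
(* One index beyond [N] that is close to [A] suffices; the Cauchy property carries this closeness to
   all later indices. *)
have [j [Nj hj]] := fultra_ex2 ge (hA k _ e3).
exists N => // i /= Ni.
have hj' : hausdorff (graph_profile R (G j) k) (op_profile P A k) < e / 2.
  by apply: le_lt_trans hj _; lra.
by apply: le_trans (hausdorff_triangle (lG i k) (lG j k) (lA k) (hN i j Ni Nj) hj') _; lra.
Qed.
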